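(* There are constants $C_0,C_1>0$ such that the following holds. Let $p,q\le 0.75$ be parameters with $p>q$ such that $\max\{p(1-p),q(1-q)\}\ge C_0(\log n)/n$. Let $G$ be a random graph sampled from $\mathrm{USSBM}(n,k,p,q)$. If $$n\ \ge\ C_1\cdot(\log n)^{14}\cdot p(1-q)\cdot k^2/(p-q)^2,$$ then the Centered-SVD Algorithm (with a suitable threshold $\Delta>0$ depending on $n,k,p,q$) recovers all the clusters with probability $1-O(1/n)$.
   Context: $\mathrm{USSBM}(n,k,p,q)$: each of the $n$ vertices $v_1,\dots,v_n$ is assigned independently and uniformly at random to one of $k$ clusters $V_1,\dots,V_k$; then, conditionally on this partition, for all pairs of vertices $v_i,v_j$ the edge $(v_i,v_j)$ is added independently with probability $p$ if $v_i,v_j$ are in the same cluster and with probability $q$ otherwise. The pairs include $i=j$, so the adjacency matrix $A$ is a random symmetric $0/1$ matrix whose entries on and above the diagonal are (conditionally) independent with mean $p$ if the two vertices lie in the same cluster (including $i=j$) and $q$ otherwise. Centered-SVD Algorithm. Input: the graph $G$ and parameters $p,q,k>0$. Let $A$ be the adjacency matrix of $G$ and $B:=A-q\cdot\mathbf 1^{n\times n}$, where $\mathbf 1^{n\times n}$ is the all-ones matrix. Let $P^k_B$ be the orthogonal projection onto the span of the first $k$ eigenvectors of $B$, where the eigenvectors are orthonormal and ordered by decreasing eigenvalue $\lambda_1(B)\ge\dots\ge\lambda_n(B)$. Choose a parameter $\Delta>0$ depending on $n,k,p,q$. For every pair of vertices, with corresponding columns $\boldsymbol u,\boldsymbol v$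 of $B$: if $\|P^k_B\boldsymbol u-P^k_B\boldsymbol v\|_2\le\Delta$, put the two vertices in the same cluster. ''Recovers all the clusters'' means that the sets formed by the algorithm are exactly the hidden clusters. Probability is over the random partition and the random graph; the constant implied by $O(1/n)$ is absolute. *)

(* Defs.v *)
From HB Require Import structures.
From mathcomp Require Import all_boot all_order all_algebra.
From mathcomp Require Import reals exp.

Set Implicit Arguments.
Unset Strict Implicit.
Unset Printing Implicit Defensive.

Import Order.TTheory GRing.Theory Num.Theory.
Local Open Scope ring_scope.

Definition edge_prob (R : realType) (n k : nat) (p q : R)
    (c : {ffun 'I_n -> 'I_k}) (i j : 'I_n) : R :=
  if c i == c j then p else q.

(* An outcome of USSBM(n,k,p,q) is a pair (c, A) of a cluster assignment and
   an adjacency matrix.  The mass is k^-n times the product over the entries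
   on and above the diagonal; non-symmetric matrices have mass 0. *)
Definition outcome (n k : nat) : finType :=
  ({ffun 'I_n -> 'I_k} * 'M[bool]_n)%type.

Definition ussbm_mass (R : realType) (n k : nat) (p q : R)
    (w : outcome n k) : R :=
  if w.2^T == w.2 then
    k%:R ^- n * \prod_(ij : 'I_n * 'I_n | (ij.1 <= ij.2)%N)
                   (if w.2 ij.1 ij.2 then edge_prob p q w.1 ij.1 ij.2
                    else 1 - edge_prob p q w.1 ij.1 ij.2)
  else 0.

Definition ussbm_Pr (R : realType) (n k : nat) (p q : R)
    (E : pred (outcome n k)) : R :=
  \sum_(w : outcome n k | E w) ussbm_mass p q w.

Lemma ussbm_Pr_ge0 (R : realType) (n k : nat) (p q : R)
    (E : pred (outcome n k)) :
  0 <= p <= 1 -> 0 <= q <= 1 -> 0 <= ussbm_Pr p q E.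
Proof.
move=> /andP[p0 p1] /andP[q0 q1]; apply: sumr_ge0 => -[c A] _.
rewrite /ussbm_mass /=; case: ifP => // _.
apply: mulr_ge0; first by rewrite invr_ge0 exprn_ge0.
by apply: prodr_ge0 => ij _; rewrite /edge_prob; do 2 case: ifP => _ //;
  rewrite subr_ge0.
Qed.

Lemma ussbm_Pr_total (R : realType) (n k : nat) (p q : R) :
  (0 < k)%N -> ussbm_Pr p q (@predT (outcome n k)) = 1.
Proof.
move=> k0; rewrite /ussbm_Pr.
pose P (ij : 'I_n * 'I_n) := (ij.1 <= ij.2)%N.
have sumA (c : {ffun 'I_n -> 'I_k}) :
    \sum_(A : 'M[bool]_n) ussbm_mass p q (c, A) = k%:R ^- n.
  pose F ij (b : bool) := if b then edge_prob p q c ij.1 ij.2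
                          else 1 - edge_prob p q c ij.1 ij.2.
  rewrite /ussbm_mass /= -big_mkcond /= -mulr_sumr.
  suff -> : \sum_(A : 'M[bool]_n | A^T == A)
      \prod_(ij : 'I_n * 'I_n | P ij) F ij (A ij.1 ij.2) = 1.
    by rewrite mulr1.
  transitivity (\prod_(ij | P ij) \sum_(b : bool) F ij b); last first.
    by apply: big1 => ij _; rewrite big_bool /F /= [LHS]addrC subrK.
  rewrite (big_distr_big_dep false) /=.
  pose h (f : {ffun 'I_n * 'I_n -> bool}) : 'M[bool]_n :=
    \matrix_(i, j) (if P (i, j) then f (i, j) else f (j, i)).
  pose h' (A : 'M[bool]_n) := [ffun ij => P ij && A ij.1 ij.2].
  rewrite (reindex_onto h h') /=; last first.
    move=> A /eqP AT; apply/matrixP => i j; rewrite !mxE !ffunE /P /=.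
    case: leqP => //= ij; rewrite (ltnW ij) /=.
    by rewrite -{1}AT mxE.
  apply: eq_big => [f|f _]; last first.
    by apply: eq_bigr => -[i j] Pij; rewrite !mxE Pij.
  apply/andP/pfamilyP => [[_ /eqP <-]|[fP _]].
    split=> //; apply/subsetP => ij; rewrite inE ffunE => Pij.
    by change (is_true (P ij)); case: (P ij) Pij.
  split.
    apply/eqP/matrixP => i j; rewrite !mxE /P /=.
    by case: (ltngtP i j) => // /val_inj ->.
  apply/eqP/ffunP => -[i j]; rewrite !ffunE mxE.
  have [//|/negP nP] := boolP (P (i, j)); rewrite /=.
  by apply/esym/negP => /negP fij; apply: nP; move/subsetP: fP => /(_ (i, j));
    apply; rewrite inE; case: (f _) fij.
rewrite -(pair_bigA _ (fun c A => ussbm_mass p q (c, A))) /=.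
under eq_bigr do rewrite sumA.
rewrite sumr_const card_ffun !card_ord -[LHS]mulr_natr natrX mulVf //.
by rewrite expf_neq0 // pnatr_eq0 -lt0n.
Qed.

Definition adjacency (R : realType) (n : nat) (A : 'M[bool]_n) : 'M[R]_n :=
  \matrix_(i, j) (A i j)%:R.

Definition centered_adjacency (R : realType) (n : nat) (q : R)
    (A : 'M[bool]_n) : 'M[R]_n :=
  adjacency R A - const_mx q.

(* The rows of U are orthonormal eigenvectors of B, listed by decreasing
   eigenvalue lam 0 0 >= lam 0 1 >= ... *)
Definition ordered_eigenbasis (R : realType) (n : nat) (B U : 'M[R]_n)
    (lam : 'rV[R]_n) : Prop :=
  [/\ U *m U^T = 1%:M,
      forall i : 'I_n, B *m (row i U)^T = lam 0 i *: (row i U)^T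
    & forall i j : 'I_n, (i <= j)%N -> lam 0 j <= lam 0 i].

(* P projects orthogonally onto the row space of V.  The range of a symmetric
   P is its row space. *)
Definition orthogonal_projection_onto (R : realType) (m n : nat)
    (V : 'M[R]_(m, n)) (P : 'M[R]_n) : Prop :=
  [/\ P *m P = P, P^T = P & (P == V)%MS].

Definition top_eigenprojection (R : realType) (n : nat) (k : nat)
    (B P : 'M[R]_n) : Prop :=
  exists (U : 'M[R]_n) (lam : 'rV[R]_n), ordered_eigenbasis B U lam /\
    orthogonal_projection_onto (\sum_(i < n | (i < k)%N) <<row i U>>)%MS P.

(* If the k-th and (k+1)-st eigenvalues coincide then P^k_B depends on the
   chosen eigenbasis; a rule fixes one admissible choice for every symmetric
   matrix. *)
Definition top_eigenprojection_rule (R : realType) (n : nat) (k : nat)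
    (proj : 'M[R]_n -> 'M[R]_n) : Prop :=
  forall B : 'M[R]_n, B^T = B -> top_eigenprojection k B (proj B).

Definition l2norm (R : realType) (n : nat) (x : 'cV[R]_n) : R :=
  Num.sqrt (\sum_(i < n) x i 0 ^+ 2).

Definition put_together (R : realType) (n : nat)
    (proj : 'M[R]_n -> 'M[R]_n) (q Delta : R) (A : 'M[bool]_n)
    (u v : 'I_n) : bool :=
  let B := centered_adjacency q A in
  l2norm (proj B *m col u B - proj B *m col v B) <= Delta.

(* The relation put_together need not be transitive.  The set formed around u
   consists of the vertices directly put together with u, so if these sets are
   the hidden clusters, then put_together is exactly the relation of lying in
   the same cluster. *)
Definition centered_svd (R : realType) (n : nat)
    (proj : 'M[R]_n -> 'M[R]_n) (q Delta : R) (A : 'M[bool]_n) :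
    {set {set 'I_n}} :=
  [set [set v | put_together proj q Delta A u v] | u : 'I_n].

Definition hidden_clusters (n k : nat) (c : {ffun 'I_n -> 'I_k}) :
    {set {set 'I_n}} :=
  [set [set v | c v == a] | a : 'I_k].

Definition recovers (R : realType) (n k : nat)
    (proj : 'M[R]_n -> 'M[R]_n) (q Delta : R) : pred (outcome n k) :=
  fun w => centered_svd proj q Delta w.2 == hidden_clusters w.1.

(* Main.v *)
Require Import Defs.
From mathcomp Require Import all_boot all_order all_algebra.
From mathcomp Require Import reals sequences exp.
From mathcomp Require Import ring lra zify.

(** Let [M] be the matrix with entry [p - q] inside the clusters and [0] between
    them, so that the centred adjacency matrix is [B = M + H], where [H] has
    centred entries that are independent on and above the diagonal, with
    variance at most [sg2 = max (p (1 - p)) (q (1 - q))]. Let [P] be the top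
    projection of [B] and [s = (p - q) n / (2 k)], a lower bound on the nonzero
    eigenvalues of [M]. Two columns of [M] are equal inside a cluster, and
    otherwise their squared distance is about [2 (p - q)^2 n / k], nearly all
    of which survives [P]. The algorithm is therefore correct as soon as
    [|P H_u|^2] is a small multiple of [(p - q)^2 n / k = 4 s^2 k / n] for every
    column [H_u] ([projected_columns_separate]).

    The bound [|P H_u| <= |H_u|] is useless here, since [|H_u|^2] is about
    [n sg2]. If [P] were independent of [H_u], the rank of [P] would bring
    [|P H_u|^2] down to about [k sg2]. It is not independent, so vertex [u] is
    left out: with [P_u] the top projection of [M] plus the noise in which row
    and column [u] are erased, Chernoff's bound for a random vector independent
    of [P_u] gives
      [|P_u H_u|^2 <= 36 (ln n)^2 k (sg2 + coherence P_u)]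
    ([vertex_concentration]), where [coherence Q = max_j |Q e_j|^2] measures how
    much a projection favours one coordinate. The difference [P - P_u] is small
    by Davis and Kahan's theorem, because the erased noise has rank two and its
    product with [P_u] only involves [P_u H_u] and [P_u e_u].

    Neither coherence is known beforehand. However [B e_j = M_j + H_j], and [B]
    expands the range of [P] by about [s], so [|P e_j|] is bounded by
    [(|M_j| + |P H_j|) / s]. Together with the previous estimates this makes
    [coherence P] smaller than a multiple of [k / n] plus a small multiple of
    itself, so it is of order [k / n] ([coherence_bootstrap], [leave_one_out]).

    Two further random facts are used. The operator norm of [H] is at most
    [14 ln n * sqrt (n sg2)]: the expected trace of [H^(2m)], with [m] of order
    [ln n], is a sum over walks, and only the walks that use no edge exactly
    once contribute ([trace_moment]). All clusters have between [n / (2 k)] and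
    [2 n / k] vertices, again by Chernoff's bound ([unbalanced_small]). The
    assumed lower bound on [n] makes [s^2] larger than [n sg2] and than [k] by
    powers of [ln n], which absorbs all these losses ([parameter_regime]).

    Lengths are measured throughout by squared Frobenius norms, for which
    [|x + y|^2 <= 2 |x|^2 + 2 |y|^2] can replace the triangle inequality because
    constant factors do not matter. *)

Set Implicit Arguments.
Unset Strict Implicit.
Unset Printing Implicit Defensive.

Import Order.TTheory GRing.Theory Num.Theory.
Local Open Scope ring_scope.

(** * Squared Frobenius norms *)

Section Frobenius.
Context {R : realType}.

(** The double sum of the squares [(a i * b j - a j * b i) ^+ 2] is twice the
    difference of the two sides. *)
Lemma sum_cauchy_schwarz (I : finType) (a b : I -> R) :
  (\sum_i a i * b i) ^+ 2 <= (\sum_i a i ^+ 2) * (\sum_i b i ^+ 2).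
Proof.
have : 0 <= \sum_i \sum_j (a i * b j - a j * b i) ^+ 2.
  by do 2 (apply: sumr_ge0 => ? _); apply: sqr_ge0.
have -> : \sum_i \sum_j (a i * b j - a j * b i) ^+ 2 =
    \sum_i \sum_j a i ^+ 2 * b j ^+ 2 + \sum_i \sum_j a j ^+ 2 * b i ^+ 2
    - 2 * \sum_i \sum_j (a i * b i) * (a j * b j).
  rewrite mulr_sumr -sumrN -!big_split /=; apply: eq_bigr => i _.
  rewrite mulr_sumr -sumrN -!big_split /=; apply: eq_bigr => j _.
  ring.
rewrite [X in _ + X - _]exchange_big /= -!big_distrlr /=; lra.
Qed.

Definition frob2 m n (A : 'M[R]_(m, n)) : R := \sum_i \sum_j A i j ^+ 2.

Lemma frob2_ge0 m n (A : 'M[R]_(m, n)) : 0 <= frob2 A.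
Proof. by do 2 (apply: sumr_ge0 => ? _); apply: sqr_ge0. Qed.
Hint Resolve frob2_ge0 : core.

Lemma frob2_trace m n (A : 'M[R]_(m, n)) : frob2 A = \tr (A *m A^T).
Proof.
by apply: eq_bigr => i _; rewrite mxE; apply: eq_bigr => j _; rewrite mxE expr2.
Qed.

Lemma frob2_tr m n (A : 'M[R]_(m, n)) : frob2 A^T = frob2 A.
Proof. by rewrite !frob2_trace trmxK mxtrace_mulC. Qed.

Lemma frob2_row m n (A : 'M[R]_(m, n)) : frob2 A = \sum_i frob2 (row i A).
Proof.
apply: eq_bigr => i _; rewrite /frob2 big_ord1.
by apply: eq_bigr => j _; rewrite mxE.
Qed.

Lemma frob2_col m n (A : 'M[R]_(m, n)) : frob2 A = \sum_j frob2 (col j A).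
Proof.
rewrite -frob2_tr frob2_row; apply: eq_bigr => j _.
by rewrite -frob2_tr tr_row trmxK.
Qed.

Lemma frob2_cV n (x : 'cV[R]_n) : frob2 x = \sum_i x i 0 ^+ 2.
Proof. by apply: eq_bigr => i _; rewrite big_ord1. Qed.

Lemma frob2_entry m n (A : 'M[R]_(m, n)) i j : A i j ^+ 2 <= frob2 A.
Proof.
rewrite /frob2 (bigD1 i) //= (bigD1 j) //= -addrA lerDl addr_ge0 //.
  by apply: sumr_ge0 => ? _; apply: sqr_ge0.
by do 2 (apply: sumr_ge0 => ? _); apply: sqr_ge0.
Qed.

Lemma frob2_gt0 m n (A : 'M[R]_(m, n)) : A != 0 -> 0 < frob2 A.
Proof.
move=> A0; rewrite lt_neqAle frob2_ge0 andbT eq_sym; apply: contra A0 => /eqP F0.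
apply/eqP/matrixP => i j; rewrite mxE; apply/eqP; rewrite -sqrf_eq0.
by rewrite eq_le sqr_ge0 andbT -F0 frob2_entry.
Qed.

Lemma frob20 m n : frob2 (0 : 'M[R]_(m, n)) = 0.
Proof. by rewrite frob2_trace mul0mx mxtrace0. Qed.

Lemma frob2Z m n a (A : 'M[R]_(m, n)) : frob2 (a *: A) = a ^+ 2 * frob2 A.
Proof.
rewrite /frob2 mulr_sumr; apply: eq_bigr => i _; rewrite mulr_sumr.
by apply: eq_bigr => j _; rewrite mxE exprMn.
Qed.

Lemma frob2N m n (A : 'M[R]_(m, n)) : frob2 (- A) = frob2 A.
Proof. by rewrite -scaleN1r frob2Z sqrrN expr1n mul1r. Qed.

Lemma frob2D m n (A B : 'M[R]_(m, n)) :
  frob2 (A + B) <= 2 * frob2 A + 2 * frob2 B.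
Proof.
rewrite /frob2 !mulr_sumr -big_split /=; apply: ler_sum => i _.
rewrite !mulr_sumr -big_split /=; apply: ler_sum => j _.
by rewrite mxE; have := sqr_ge0 (A i j - B i j); lra.
Qed.

Lemma frob2B m n (A B : 'M[R]_(m, n)) :
  frob2 (A - B) <= 2 * frob2 A + 2 * frob2 B.
Proof. by rewrite -(frob2N B); apply: frob2D. Qed.

Lemma frob2M m n r (A : 'M[R]_(m, n)) (B : 'M[R]_(n, r)) :
  frob2 (A *m B) <= frob2 A * frob2 B.
Proof.
rewrite -(frob2_tr B) {1}/frob2 [leRHS]big_distrlr /=.
apply: ler_sum => i _; apply: ler_sum => j _; rewrite mxE.
apply: le_trans (sum_cauchy_schwarz _ _) _.
by rewrite [X in _ * X <= _](eq_bigr (fun k => B^T j k ^+ 2)) // => k _; rewrite mxE.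
Qed.

Lemma frob2_isometry m n r (U : 'M[R]_(m, n)) (A : 'M[R]_(n, r)) :
  U^T *m U = 1%:M -> frob2 (U *m A) = frob2 A.
Proof.
move=> UU; rewrite !frob2_trace trmx_mul mxtrace_mulC.
by rewrite -mulmxA (mulmxA U^T) UU mul1mx mxtrace_mulC.
Qed.

(** Pythagoras: the two parts of [A] are orthogonal. *)
Lemma frob2_proj_split n r (P : 'M[R]_n) (A : 'M[R]_(n, r)) :
  P^T = P -> P *m P = P -> frob2 A = frob2 (P *m A) + frob2 (A - P *m A).
Proof.
move=> PT PP; rewrite !frob2_trace [(A - _)^T]linearB /= !trmx_mul PT.
rewrite mulmxBl !mulmxBr !raddfB /= -!mulmxA.
have E : \tr (P *m (A *m (A^T *m P))) = \tr (A *m (A^T *m P)).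
  by rewrite mxtrace_mulC -!mulmxA PP.
have E2 : \tr (P *m (A *m A^T)) = \tr (A *m (A^T *m P)).
  by rewrite mxtrace_mulC mulmxA.
by rewrite E E2; ring.
Qed.

Lemma frob2_proj n r (P : 'M[R]_n) (A : 'M[R]_(n, r)) :
  P^T = P -> P *m P = P -> frob2 (P *m A) <= frob2 A.
Proof. by move=> PT PP; rewrite (frob2_proj_split A PT PP) lerDl. Qed.

Lemma qform_cauchy_schwarz n (x y : 'cV[R]_n) :
  (\tr (x^T *m y)) ^+ 2 <= frob2 x * frob2 y.
Proof.
rewrite /mxtrace big_ord1 mxE !frob2_cV.
by under eq_bigr do rewrite mxE; apply: sum_cauchy_schwarz.
Qed.

End Frobenius.
#[global] Hint Extern 0 (is_true (0 <= frob2 _)) => (exact: frob2_ge0) : core.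

(** * Eigenbases and projections onto top eigenspaces *)

Section Spectral.
Context {R : realType} {n : nat}.
Implicit Types (B U P : 'M[R]_n) (lam : 'rV[R]_n).

Lemma eigenbasis_orth B U lam : ordered_eigenbasis B U lam -> U^T *m U = 1%:M.
Proof. by case=> /mulmx1C. Qed.

Lemma eigenbasis_diag B U lam : B^T = B -> ordered_eigenbasis B U lam ->
  U *m B = diag_mx lam *m U.
Proof.
move=> BT [_ eigU _]; apply/row_matrixP => i.
rewrite row_mul -[LHS]trmxK trmx_mul BT eigU linearZ /= trmxK.
by apply/rowP => j; rewrite [RHS]mxE mul_diag_mx !mxE.
Qed.

(** In the coordinates [U *m x], the matrix [B] acts diagonally. All the spectral
    estimates below are read off entrywise in these coordinates. *)
Lemma eigenbasis_mulmx_entry B U lam r (x : 'M[R]_(n, r)) i j : B^T = B ->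
  ordered_eigenbasis B U lam -> (U *m (B *m x)) i j = lam 0 i * (U *m x) i j.
Proof.
move=> BT bU; rewrite mulmxA (eigenbasis_diag BT bU) -mulmxA mul_diag_mx mxE.
by [].
Qed.

Lemma eigenbasis_qform B U lam (x : 'cV[R]_n) : B^T = B ->
  ordered_eigenbasis B U lam ->
  \tr (x^T *m (B *m x)) = \sum_i lam 0 i * (U *m x) i 0 ^+ 2.
Proof.
move=> BT bU; rewrite -[x^T]mulmx1 -(eigenbasis_orth bU) -!mulmxA.
rewrite mulmxA -trmx_mul /mxtrace big_ord1 mxE; apply: eq_bigr => i _.
by rewrite mxE (eigenbasis_mulmx_entry _ _ _ BT bU) expr2; ring.
Qed.

Lemma frob2_eigenbasis B U lam r (x : 'M[R]_(n, r)) :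
  ordered_eigenbasis B U lam -> frob2 (U *m x) = frob2 x.
Proof. by move=> /eigenbasis_orth UU; rewrite frob2_isometry. Qed.

(** The easy half of the Courant-Fischer principle: the range of [Y] has dimension
    [k], so it contains a nonzero vector orthogonal to the first [i < k]
    eigenvectors, and on that vector the quadratic form of [B] is at most
    [lam 0 i] times the squared norm. *)
Lemma eigenvalue_lower B U lam k (Y : 'M[R]_(n, k)) c (i : 'I_n) : B^T = B ->
  ordered_eigenbasis B U lam -> row_free Y^T ->
  (forall b : 'cV_k, c * frob2 (Y *m b) <= \tr ((Y *m b)^T *m (B *m (Y *m b)))) ->
  (i < k)%N -> c <= lam 0 i.
Proof.
move=> BT bU Yfree hc ik; have [UU _ ord] := bU.
pose W : 'M[R]_(k, i) := \matrix_(a, b) (U *m Y) (widen_ord (ltnW (ltn_ord i)) b) a.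
(* A nonzero element of this kernel is a combination of the columns of [Y]
   orthogonal to the first [i] eigenvectors. *)
have : kermx W != 0.
  rewrite kermx_eq0; apply/negP => /eqP rW.
  by have := rank_leq_col W; rewrite rW leqNgt ik.
case/rowV0Pn => b /sub_kermxP bW b0.
pose x := Y *m b^T.
have x0 : x != 0.
  apply: contra b0 => /eqP x0; apply/eqP.
  apply: (row_free_inj Yfree); rewrite mul0mx.
  by rewrite -[b]trmxK -trmx_mul -/x x0 trmx0.
have Ux (j : 'I_n) : (j < i)%N -> (U *m x) j 0 = 0.
  move=> ji; move/matrixP/(_ 0 (Ordinal ji)): bW.
  rewrite mxE [in RHS]mxE => bW; rewrite mulmxA mxE -[RHS]bW.
  apply: eq_bigr => a _; rewrite [(\matrix_(_, _) _) _ _]mxE [b^T _ _]mxE mulrC.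
  by congr (_ * (U *m Y) _ _); apply: val_inj.
have := hc b^T; rewrite -/x (eigenbasis_qform _ BT bU) => hx.
have le : \sum_j lam 0 j * (U *m x) j 0 ^+ 2 <= lam 0 i * frob2 x.
  rewrite -(frob2_eigenbasis x bU) frob2_cV mulr_sumr; apply: ler_sum => j _.
  have [ji|ij] := ltnP j i; first by rewrite Ux // expr0n !mulr0.
  by apply: ler_wpM2r (ord _ _ ij); apply: sqr_ge0.
by have := le_trans hx le; rewrite ler_pM2r // frob2_gt0.
Qed.

(** Dually, the first [i + 1 > k] eigenvectors span a nonzero vector subject to any
    [k] linear conditions. *)
Lemma eigenvalue_upper B U lam k (Z : 'M[R]_(n, k)) c (i : 'I_n) : B^T = B ->
  ordered_eigenbasis B U lam ->
  (forall x : 'cV_n, x^T *m Z = 0 -> \tr (x^T *m (B *m x)) <= c * frob2 x) ->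
  (k <= i)%N -> lam 0 i <= c.
Proof.
move=> BT bU hc ki; have [UU _ ord] := bU.
pose V : 'M[R]_(i.+1, n) := \matrix_(a, b) U (widen_ord (ltn_ord i) a) b.
have : kermx (V *m Z) != 0.
  rewrite kermx_eq0; apply/negP => /eqP rW.
  by have := rank_leq_col (V *m Z); rewrite rW leqNgt ltnS ki.
case/rowV0Pn => y /sub_kermxP yW y0.
pose x := (y *m V)^T.
have xZ : x^T *m Z = 0 by rewrite trmxK -mulmxA.
have VU : V *m U^T = \matrix_(a, b) (widen_ord (ltn_ord i) a == b)%:R.
  apply/matrixP => a b; rewrite mxE.
  have := UU => /matrixP/(_ (widen_ord (ltn_ord i) a) b).
  by rewrite !mxE => <-; apply: eq_bigr => j _; rewrite !mxE.
have Ux (j : 'I_n) : (i < j)%N -> (U *m x) j 0 = 0.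
  move=> ij; rewrite -[U]trmxK -trmx_mul -mulmxA VU mxE mxE big1 // => a _.
  rewrite mxE; case: eqP => [aj|]; rewrite ?mulr0 //.
  by move: ij (ltn_ord a); rewrite -aj /= ltnS; case: ltngtP.
have x0 : 0 < frob2 x.
  rewrite frob2_gt0 //; apply: contra y0 => /eqP x0.
  have yV : y *m V = 0 by rewrite -[y *m V]trmxK -/x x0 trmx0.
  have : y *m V *m U^T = 0 by rewrite yV mul0mx.
  rewrite -mulmxA VU => /matrixP yU; apply/eqP/matrixP => a b.
  have := yU a (widen_ord (ltn_ord i) b); rewrite !mxE (bigD1 b) //= mxE eqxx mulr1.
  rewrite big1 ?addr0 // => d db; rewrite mxE; case: eqP => [dd|]; rewrite ?mulr0 //.
  by case/eqP: db; apply: val_inj; move/(congr1 val): dd.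
have := hc x xZ; rewrite (eigenbasis_qform _ BT bU) => hx.
have le : lam 0 i * frob2 x <= \sum_j lam 0 j * (U *m x) j 0 ^+ 2.
  rewrite -(frob2_eigenbasis x bU) frob2_cV mulr_sumr; apply: ler_sum => j _.
  have [ij|ji] := ltnP i j; first by rewrite Ux // expr0n !mulr0.
  by apply: ler_wpM2r (ord _ _ ji); apply: sqr_ge0.
by have := le_trans le hx; rewrite ler_pM2r.
Qed.

(** In eigencoordinates a top projection keeps the first [k] coordinates and erases
    the others. This is the form in which the projections are used, and it shows
    that they are determined by the eigenbasis. *)
Lemma top_projection_entry B U lam k P r (x : 'M[R]_(n, r)) i j :
  ordered_eigenbasis B U lam ->
  orthogonal_projection_onto (\sum_(i < n | (i < k)%N) <<row i U>>)%MS P ->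
  (U *m (P *m x)) i j = (i < k)%N%:R * (U *m x) i j.
Proof.
move=> [UU _ _] [PP PT /eqmxP eqPV].
suff rowP : row i U *m P = (i < k)%N%:R *: row i U.
  have -> : (U *m (P *m x)) i j = (row i U *m P *m x) 0 j.
    by rewrite -!row_mul [RHS]mxE mulmxA.
  by rewrite rowP -scalemxAl -row_mul mxE [X in _ * X]mxE.
have [ik|ki] := ltnP i k.
  rewrite scale1r; have : (row i U <= P)%MS.
    by rewrite eqPV; apply: (sumsmx_sup i) => //; rewrite genmxE.
  by case/submxP => y ->; rewrite -mulmxA PP.
rewrite scale0r -[LHS]trmxK trmx_mul PT.
suff /sub_kermxP -> : (P <= kermx (row i U)^T)%MS by rewrite trmx0.
rewrite eqPV; apply/sumsmx_subP => j' j'k; rewrite genmxE; apply/sub_kermxP.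
rewrite tr_row.
apply/matrixP => a b; have /matrixP/(_ j' i) := UU; rewrite !mxE.
have /negbTE -> : j' != i by apply: contraL j'k => /eqP ->; rewrite -leqNgt.
by move=> U0; apply: etrans U0; apply: eq_bigr => l _; rewrite !mxE.
Qed.

Lemma frob2_top_projection B U lam k P r (x : 'M[R]_(n, r)) :
  ordered_eigenbasis B U lam ->
  orthogonal_projection_onto (\sum_(i < n | (i < k)%N) <<row i U>>)%MS P ->
  frob2 (P *m x) = \sum_(i < n | (i < k)%N) \sum_j (U *m x) i j ^+ 2.
Proof.
move=> bU oP; rewrite -(frob2_eigenbasis _ bU) /frob2 [RHS]big_mkcond /=.
apply: eq_bigr => i _; under eq_bigr do rewrite (top_projection_entry _ _ _ bU oP).
by case: ifP => _; [under eq_bigr do rewrite mul1r | under eq_bigr do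
  rewrite mul0r expr0n; rewrite big1].
Qed.

Lemma trace_top_projection B U lam k P :
  ordered_eigenbasis B U lam ->
  orthogonal_projection_onto (\sum_(i < n | (i < k)%N) <<row i U>>)%MS P ->
  (k <= n)%N -> \tr P = k%:R.
Proof.
move=> bU oP kn; have [PP PT _] := oP.
have -> : \tr P = frob2 (P *m U^T).
  rewrite -[frob2 _]frob2_tr trmx_mul trmxK PT (frob2_eigenbasis _ bU).
  by rewrite frob2_trace PT PP.
have [UU _ _] := bU; rewrite (frob2_top_projection _ bU oP) UU.
under eq_bigr => i _.
  rewrite (bigD1 i) //= mxE eqxx expr1n big1 ?addr0; last first.
    by move=> j /negbTE ji; rewrite mxE eq_sym ji expr0n.
  over.
rewrite sumr_const; congr (_%:R).
rewrite -[RHS](card_ord k) -(card_image (f := widen_ord kn)); last first.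
  by move=> a b /(congr1 val) /= /val_inj.
apply: eq_card => i; apply/idP/imageP => [ik|[a _ ->]]; last first.
  by rewrite unfold_in /=; exact: ltn_ord.
by exists (Ordinal ik) => //; apply: val_inj.
Qed.

(** [B] commutes with [P] and expands its range by at least [g]; hence a bound on
    [P *m (B *m x)], where [B *m x] is explicit, bounds [P *m x]. *)
Lemma top_projection_gain B U lam k P g r (x : 'M[R]_(n, r)) : B^T = B ->
  ordered_eigenbasis B U lam ->
  orthogonal_projection_onto (\sum_(i < n | (i < k)%N) <<row i U>>)%MS P ->
  0 <= g -> (forall i : 'I_n, (i < k)%N -> g <= lam 0 i) ->
  g ^+ 2 * frob2 (P *m x) <= frob2 (P *m (B *m x)).
Proof.
move=> BT bU oP g0 hg; rewrite !(frob2_top_projection _ bU oP) mulr_sumr.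
apply: ler_sum => i ik; rewrite mulr_sumr; apply: ler_sum => j _.
rewrite (eigenbasis_mulmx_entry _ _ _ BT bU) exprMn ler_wpM2r ?sqr_ge0 //.
by rewrite ler_sqr ?nnegrE ?hg // (le_trans g0) ?hg.
Qed.

(** What [P] removes from the range of [B] lies along eigenvectors with small
    eigenvalues. *)
Lemma top_projection_residual B U lam k P e r (x : 'M[R]_(n, r)) : B^T = B ->
  ordered_eigenbasis B U lam ->
  orthogonal_projection_onto (\sum_(i < n | (i < k)%N) <<row i U>>)%MS P ->
  (forall i : 'I_n, (k <= i)%N -> `|lam 0 i| <= e) ->
  frob2 (B *m x - P *m (B *m x)) <= e ^+ 2 * frob2 x.
Proof.
move=> BT bU oP he.
rewrite -(frob2_eigenbasis _ bU) -(frob2_eigenbasis x bU) mulmxBr /frob2.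
rewrite mulr_sumr; apply: ler_sum => i _; rewrite mulr_sumr; apply: ler_sum => j _.
rewrite mxE [X in _ + X]mxE (top_projection_entry _ _ _ bU oP).
rewrite (eigenbasis_mulmx_entry _ _ _ BT bU).
have [ik|ki] := ltnP i k.
  by rewrite mul1r subrr expr0n mulr_ge0 ?sqr_ge0.
rewrite mul0r subr0 exprMn ler_wpM2r ?sqr_ge0 // -real_normK ?num_real //.
have e0 : 0 <= e by apply: le_trans (he i ki).
by rewrite ler_sqr ?nnegrE ?he.
Qed.

(** The Frobenius form of the Davis-Kahan theorem. In the two eigenbases the
    matrix [U *m (B - B') *m U'^T] has entries [lam i - lam' j] times those of
    [U *m U'^T], and the gap bounds this factor below on the block
    [k <= i], [j < k], which is all that [P' - P *m P'] sees. *)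
Lemma davis_kahan B B' U U' lam lam' k P P' e g : B^T = B -> B'^T = B' ->
  ordered_eigenbasis B U lam -> ordered_eigenbasis B' U' lam' ->
  orthogonal_projection_onto (\sum_(i < n | (i < k)%N) <<row i U>>)%MS P ->
  orthogonal_projection_onto (\sum_(i < n | (i < k)%N) <<row i U'>>)%MS P' ->
  (forall i : 'I_n, (k <= i)%N -> lam 0 i <= e) ->
  (forall i : 'I_n, (i < k)%N -> g <= lam' 0 i) -> e <= g ->
  (g - e) ^+ 2 * frob2 (P' - P *m P') <= frob2 ((B - B') *m P').
Proof.
move=> BT B'T bU bU' oP oP' he hg eg.
have colP' (A : 'M[R]_n) i j : (A *m P' *m U'^T) i j = (j < k)%N%:R * (A *m U'^T) i j.
  have [_ P'T _] := oP'.
  rewrite -[A *m P' *m _]trmxK mxE !trmx_mul trmxK P'T.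
  rewrite (top_projection_entry _ _ _ bU' oP') -[U' *m A^T]trmxK mxE.
  by rewrite trmx_mul !trmxK.
have frobU (A : 'M[R]_n) : frob2 A = frob2 (U *m A *m U'^T).
  rewrite -mulmxA (frob2_eigenbasis _ bU) -[RHS]frob2_tr trmx_mul trmxK.
  by rewrite (frob2_eigenbasis _ bU') frob2_tr.
have lamE i j : (U *m (B - B') *m U'^T) i j =
    (lam 0 i - lam' 0 j) * (U *m U'^T) i j.
  rewrite mulmxBr mulmxBl (eigenbasis_diag BT bU) mxE [X in _ + X]mxE.
  have -> : U *m B' *m U'^T = U *m U'^T *m diag_mx lam'.
    rewrite -!mulmxA; congr (_ *m _); rewrite -[LHS]trmxK trmx_mul trmxK B'T.
    by rewrite (eigenbasis_diag B'T bU') trmx_mul tr_diag_mx.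
  rewrite -(mulmxA (diag_mx lam)) mul_diag_mx mul_mx_diag.
  by rewrite [X in X - _]mxE [X in _ - X]mxE; ring.
rewrite (frobU (P' - _)) (frobU (_ *m P')) /frob2.
rewrite mulr_sumr; apply: ler_sum => i _; rewrite mulr_sumr; apply: ler_sum => j _.
rewrite (mulmxA U (B - B')) colP' lamE.
have -> : U *m (P' - P *m P') = (U - U *m P) *m P'.
  by rewrite mulmxBr mulmxBl mulmxA.
rewrite colP'.
have -> : ((U - U *m P) *m U'^T) i j = (k <= i)%N%:R * (U *m U'^T) i j.
  rewrite mulmxBl -(mulmxA U P) mxE [X in _ + X]mxE.
  rewrite (top_projection_entry _ _ _ bU oP) (leqNgt k i).
  by case: (i < k)%N; rewrite ?mul1r ?mul0r ?subrr ?subr0 ?mul1r.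
have [jk|kj] := ltnP j k; last by rewrite !mul0r expr0n mulr0.
have [ki|ik] := leqP k i; last by rewrite mul0r mulr0 expr0n mulr0 sqr_ge0.
rewrite !mul1r [leRHS]exprMn ler_wpM2r ?sqr_ge0 // -[leRHS]sqrrN opprB.
rewrite ler_sqr ?nnegrE ?subr_ge0 //; last first.
  exact: le_trans (he _ ki) (le_trans eg (hg _ jk)).
by rewrite lerB ?he ?hg.
Qed.

(** For projections of equal rank, the defects [P' - P *m P'] and [P - P' *m P]
    have the same norm, so controlling one controls [P - P']. *)
Lemma frob2_projB P P' : P^T = P -> P *m P = P -> P'^T = P' -> P' *m P' = P' ->
  \tr P = \tr P' -> frob2 (P - P') = 2 * frob2 (P' - P *m P').
Proof.
move=> PT PP P'T P'P' tPP'; have := frob2_proj_split P' PT PP.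
have E1 : \tr (P' *m P) = \tr (P *m P') by rewrite mxtrace_mulC.
have -> : frob2 P' = \tr P' by rewrite frob2_trace P'T P'P'.
have -> : frob2 (P *m P') = \tr (P *m P').
  rewrite frob2_trace trmx_mul PT P'T -mulmxA (mulmxA P') P'P'.
  by rewrite mxtrace_mulC -mulmxA PP.
have -> : frob2 (P - P') = \tr P + \tr P' - 2 * \tr (P *m P').
  rewrite frob2_trace linearB /= PT P'T mulmxBl !mulmxBr PP P'P' !raddfB /= E1.
  ring.
by rewrite tPP'; lra.
Qed.

End Spectral.

(** * Noise matrices and deletion of a vertex *)

Section OperatorBound.
Context {R : realType} {n : nat}.
Implicit Types (H P : 'M[R]_n).

(** A bound on the operator norm, for [0 <= e]. *)
Definition op_bound (e : R) H :=
  forall x : 'cV[R]_n, frob2 (H *m x) <= e ^+ 2 * frob2 x.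

Lemma op_bound_qform e H (x : 'cV[R]_n) : 0 <= e -> op_bound e H ->
  `|\tr (x^T *m (H *m x))| <= e * frob2 x.
Proof.
move=> e0 He; rewrite -ler_sqr ?nnegrE ?mulr_ge0 // real_normK ?num_real //.
apply: le_trans (qform_cauchy_schwarz _ _) _.
by rewrite exprMn expr2 [frob2 x ^+ 2]expr2 mulrCA ler_wpM2l // -expr2 He.
Qed.

Definition drop_vertex (u : 'I_n) H : 'M[R]_n :=
  \matrix_(i, j) (if (i == u) || (j == u) then 0 else H i j).

Lemma drop_vertex_sym u H : H^T = H -> (drop_vertex u H)^T = drop_vertex u H.
Proof.
by move=> HT; apply/matrixP => i j; rewrite !mxE orbC -[in RHS]HT mxE.
Qed.

Lemma op_bound_drop_vertex e u H : op_bound e H -> op_bound e (drop_vertex u H).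
Proof.
move=> He x; pose y : 'cV[R]_n := \col_i (if i == u then 0 else x i 0).
have Hy i : (drop_vertex u H *m x) i 0 ^+ 2 <= (H *m y) i 0 ^+ 2.
  have [->|iu] := eqVneq i u.
    rewrite mxE big1 ?expr0n ?sqr_ge0 // => j _.
    by rewrite mxE eqxx mul0r.
  rewrite !mxE (eq_bigr (fun j => H i j * y j 0)) // => j _.
  by rewrite !mxE (negbTE iu); case: eqP; rewrite ?mul0r ?mulr0.
have yx : frob2 y <= frob2 x.
  rewrite !frob2_cV; apply: ler_sum => i _; rewrite mxE.
  by case: eqP => // _; rewrite expr0n sqr_ge0.
apply: le_trans (_ : frob2 (H *m y) <= _).
  by rewrite !frob2_cV; apply: ler_sum => i _; apply: Hy.
by apply: le_trans (He y) _; rewrite ler_wpM2l ?sqr_ge0.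
Qed.

Lemma frob2_delta u : frob2 (delta_mx u 0 : 'cV[R]_n) = 1.
Proof.
rewrite frob2_cV (bigD1 u) //= mxE !eqxx expr1n big1 ?addr0 // => i iu.
by rewrite mxE (negbTE iu) expr0n.
Qed.

Lemma op_bound_col e H u : op_bound e H -> frob2 (col u H) <= e ^+ 2.
Proof.
by move=> He; rewrite colE; have := He (delta_mx u 0); rewrite frob2_delta mulr1.
Qed.

(** The deleted part is [e_u a^T + b e_u^T], where [a] is column [u] of [H] and
    [b] is the same column with its own entry [u] erased. Only the two vectors
    [P *m a] and [P *m e_u] are then relevant, and this is what makes
    deletion of one vertex a small perturbation for a projection that is
    nearly orthogonal to both. *)
Lemma drop_vertex_rank2 e u H P : H^T = H -> op_bound e H -> P^T = P ->
  frob2 ((H - drop_vertex u H) *m P) <=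
    2 * frob2 (P *m col u H) + 2 * e ^+ 2 * frob2 (col u P).
Proof.
move=> HT He PT.
pose b : 'cV[R]_n := \col_i (if i == u then 0 else H i u).
have -> : H - drop_vertex u H =
    delta_mx u 0 *m (col u H)^T + b *m (delta_mx u (0 : 'I_1))^T.
  apply/matrixP => i j; rewrite !mxE !big_ord1 !mxE /= !eqxx !andbT.
  have Hij : H j u = H u j by rewrite -[in LHS]HT mxE.
  have [->|iu] := eqVneq i u; rewrite ?mul1r ?mul0r ?add0r ?addr0 ?subr0 ?Hij //=.
  by have [->|ju] := eqVneq j u; rewrite ?mulr1 ?mulr0 ?subr0 ?subrr.
rewrite mulmxDl; apply: le_trans (frob2D _ _) _.
have tr1 (v w : 'cV[R]_n) : frob2 (v *m w^T *m P) <= frob2 v * frob2 (P *m w).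
  have -> : v *m w^T *m P = v *m (P *m w)^T by rewrite trmx_mul PT mulmxA.
  by rewrite -[X in _ * X]frob2_tr frob2M.
apply: lerD; last rewrite -mulrA; rewrite ler_wpM2l //.
  by apply: le_trans (tr1 _ _) _; rewrite frob2_delta mul1r.
apply: le_trans (tr1 _ _) _; rewrite -colE ler_wpM2r //.
apply: le_trans _ (op_bound_col u He); rewrite !frob2_cV; apply: ler_sum => i _.
by rewrite !mxE; case: eqP => // _; rewrite expr0n sqr_ge0.
Qed.

Definition coherence P : R := \big[Num.max/0]_i frob2 (col i P).

Lemma coherence_ge0 P : 0 <= coherence P.
Proof. exact: bigmax_ge_id. Qed.

Lemma le_coherence P i : frob2 (col i P) <= coherence P.
Proof. exact: (le_bigmax _ (fun i => frob2 (col i P))). Qed.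

Lemma coherence_le P a :
  0 <= a -> (forall i, frob2 (col i P) <= a) -> coherence P <= a.
Proof. by move=> a0 aP; apply: bigmax_le. Qed.

End OperatorBound.

(** * The block matrix of a partition *)

Section BlockModel.
Variables (R : realType) (n k : nat) (c : {ffun 'I_n -> 'I_k}).

Definition block_mean (d : R) : 'M[R]_n :=
  \matrix_(i, j) (if c i == c j then d else 0).

Definition membership : 'M[R]_(n, k) := \matrix_(i, a) (c i == a)%:R.

Definition cluster_size (a : 'I_k) : R := #|[set i | c i == a]|%:R.

Lemma cluster_sizeE a : cluster_size a = \sum_i (c i == a)%:R.
Proof.
rewrite /cluster_size -sum1_card natr_sum big_mkcond /=.
by apply: eq_bigr => i _; rewrite inE; case: eqP.
Qed.

Lemma block_mean_sym d : (block_mean d)^T = block_mean d.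
Proof. by apply/matrixP => i j; rewrite !mxE eq_sym. Qed.

Lemma block_meanE d : block_mean d = d *: (membership *m membership^T).
Proof.
apply/matrixP => i j; rewrite !mxE (bigD1 (c i)) //= !mxE eqxx mul1r big1.
  by rewrite addr0 [_ == c i]eq_sym; case: eqP; rewrite ?mulr1 ?mulr0.
by move=> a ac; rewrite !mxE [c i == a]eq_sym (negbTE ac) mul0r.
Qed.

Lemma membership_gram : membership^T *m membership = diag_mx (\row_a cluster_size a).
Proof.
apply/matrixP => a b; rewrite !mxE cluster_sizeE.
have [<-|ab] := eqVneq a b.
  rewrite mulr1n; apply: eq_bigr => i _.
  by rewrite !mxE; case: eqP; rewrite ?mulr1 ?mulr0.
rewrite mulr0n big1 // => i _; rewrite !mxE; case: eqP => [->|]; rewrite ?mul0r //.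
by rewrite (negbTE ab) mulr0.
Qed.

Lemma frob2_membership (b : 'cV[R]_k) :
  frob2 (membership *m b) = \sum_a cluster_size a * b a 0 ^+ 2.
Proof.
rewrite -frob2_tr frob2_trace trmxK trmx_mul -mulmxA (mulmxA membership^T).
rewrite membership_gram /mxtrace big_ord1 mxE; apply: eq_bigr => a _.
by rewrite mul_diag_mx !mxE; ring.
Qed.

Lemma block_mean_qform d (x : 'cV[R]_n) :
  \tr (x^T *m (block_mean d *m x)) = d * frob2 (membership^T *m x).
Proof.
rewrite block_meanE -scalemxAl -scalemxAr linearZ /=; congr (_ * _).
by rewrite -frob2_tr frob2_trace trmxK trmx_mul trmxK !mulmxA.
Qed.

(** The noise moves the spectrum by at most [e]. The range of [membership] supplies
    [k] dimensions on which the block matrix is at least [d * lo], and its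
    orthogonal complement is the kernel of the block matrix. *)
Lemma block_eigenvalues d lo e (H U : 'M[R]_n) lam : H^T = H ->
  0 <= d -> 0 < lo -> 0 <= e ->
  (forall a, lo <= cluster_size a) -> op_bound e H ->
  ordered_eigenbasis (block_mean d + H) U lam ->
  (forall i : 'I_n, (i < k)%N -> d * lo - e <= lam 0 i) /\
  (forall i : 'I_n, (k <= i)%N -> `|lam 0 i| <= e).
Proof.
move=> HT d0 lo0 e0 hlo He bU.
have BT : (block_mean d + H)^T = block_mean d + H.
  by rewrite linearD /= HT block_mean_sym.
have qE (x : 'cV[R]_n) : \tr (x^T *m ((block_mean d + H) *m x)) =
    d * frob2 (membership^T *m x) + \tr (x^T *m (H *m x)).
  by rewrite mulmxDl mulmxDr linearD /= block_mean_qform.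
have qH (x : 'cV[R]_n) : - (e * frob2 x) <= \tr (x^T *m (H *m x)) <= e * frob2 x.
  by rewrite -ler_norml op_bound_qform.
split=> [i|i ki].
  apply: (eigenvalue_lower (Y := membership) BT bU) => //.
    apply/row_freeP; exists (membership *m diag_mx (\row_a (cluster_size a)^-1)).
    rewrite mulmxA membership_gram; apply/matrixP => a b.
    rewrite mul_diag_mx !mxE; have [_|_] := eqVneq a b; rewrite ?mulr0n ?mulr0 //.
    by rewrite !mulr1n divff // gt_eqF // (lt_le_trans lo0).
  move=> b; set x := _ *m b; rewrite qE.
  have : d * (lo * frob2 x) <= d * frob2 (membership^T *m x).
    rewrite ler_wpM2l // /x frob2_membership mulmxA membership_gram mulr_sumr frob2_cV.
    apply: ler_sum => a _; rewrite mul_diag_mx !mxE exprMn mulrA ler_wpM2r ?sqr_ge0 //.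
    by rewrite expr2 ler_wpM2r // ltW // (lt_le_trans lo0).
  by have /andP[] := qH x; lra.
rewrite ler_norml; apply/andP; split.
  have : row_free (1%:M : 'M[R]_n)^T by rewrite trmx1 row_free_unit unitmx1.
  move/(eigenvalue_lower BT bU (c := - e) (i := i)); apply; last exact: ltn_ord.
  move=> b; rewrite mul1mx qE; have /andP[+ _] := qH b.
  by have : 0 <= d * frob2 (membership^T *m b) by [rewrite mulr_ge0|]; lra.
apply: (eigenvalue_upper (Z := membership) BT bU) => // x xZ.
rewrite qE -[membership^T *m x]trmxK trmx_mul trmxK xZ trmx0 frob20 mulr0 add0r.
by have /andP[] := qH x.
Qed.

Lemma frob2_col_block_mean d u :
  frob2 (col u (block_mean d)) = d ^+ 2 * cluster_size (c u).
Proof.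
rewrite frob2_cV cluster_sizeE mulr_sumr; apply: eq_bigr => i _; rewrite !mxE.
by case: eqP; rewrite ?mulr1 ?mulr0 ?expr0n.
Qed.

Lemma block_mean_separation d u v : c u != c v ->
  frob2 (col u (block_mean d) - col v (block_mean d)) =
    d ^+ 2 * (cluster_size (c u) + cluster_size (c v)).
Proof.
move=> cuv; rewrite frob2_cV !cluster_sizeE -big_split mulr_sumr /=.
apply: eq_bigr => i _; rewrite !mxE.
case: eqP => [->|_]; first by rewrite (negbTE cuv) subr0 addr0 mulr1.
by case: eqP; rewrite ?sub0r ?sqrrN ?add0r ?mulr1 ?subr0 ?expr0n ?mulr0.
Qed.

(** The columns of the block matrix are images of short vectors: the preimage below
    spreads its mass evenly over the cluster of [u]. The top projection of a
    perturbation therefore loses little of them. *)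
Lemma block_mean_preimage d u : cluster_size (c u) != 0 ->
  exists2 y : 'cV[R]_n, block_mean d *m y = col u (block_mean d) &
    frob2 y = (cluster_size (c u))^-1.
Proof.
move=> s0; exists ((cluster_size (c u))^-1 *: col (c u) membership).
  apply/colP => i; rewrite mxE [RHS]mxE [block_mean _ _ _]mxE.
  under eq_bigr do rewrite !mxE.
  have [ciu|ciu] := eqVneq (c i) (c u).
    rewrite (eq_bigr (fun j => d / cluster_size (c u) * (c j == c u)%:R)).
      by rewrite -mulr_sumr -cluster_sizeE divfK.
    by move=> j _; rewrite ciu eq_sym; case: eqP; rewrite ?mulr1 ?mulr0 ?mul0r.
  rewrite big1 // => j _; case: (c j =P c u) => [->|]; last by rewrite !mulr0.
  by rewrite (negbTE ciu) mul0r.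
rewrite frob2Z frob2_cV (eq_bigr (fun i => (c i == c u)%:R)).
  by rewrite -cluster_sizeE expr2 -mulrA mulVf ?mulr1.
by move=> i _; rewrite !mxE; case: eqP; rewrite ?expr1n ?expr0n.
Qed.

End BlockModel.

(** * Leaving one vertex out *)

(** The circular system of estimates and its resolution, for one deleted vertex.
    Here [s2] is the square of the signal eigenvalue, [K = k / n], [X] is the
    coherence of [P], [x] and [y] are the squared norm of a column of [P] and the
    coherence of [P_u], [z] and [w] are the squared norms of [P_u H_u] and [P H_u],
    and [D] is that of [P - P_u]. The factor [1 / 100 / 100] stands for the ratio
    of noise to signal; it makes the coefficient of [X] in the bound for [x]
    smaller than one, so that the maximum over the columns of [P] gives a bound
    on [X]. *)
Lemma coherence_bootstrap (R : realType) (s2 K X x y z D w : R) :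
  0 < s2 -> 0 <= K -> 0 <= X -> 0 <= y ->
  z <= s2 / 100 / 100 * (K + y) ->
  s2 * D <= 16 * z + 512 * (s2 / 100 / 100 * K) ->
  y <= 2 * X + 2 * D ->
  w <= 2 * z + 2 * (s2 / 100 / 100 * D) ->
  s2 * x <= 64 * (s2 * K) + 8 * w ->
  w <= s2 * ((5 * K + 9 * X) / 100 / 100) /\ x <= 65 * K + X / 10.
Proof.
move=> s20 K0 X0 y0 hz hD hy hw hx.
have sX : 0 <= s2 * X by rewrite mulr_ge0 // ltW.
have sK : 0 <= s2 * K by rewrite mulr_ge0 // ltW.
have D1 : D <= (528 * K + 16 * y) / 100 / 100.
  by rewrite -(ler_pM2l s20); lra.
have y1 : y <= 4 * X + K by lra.
have w1 : w <= s2 * ((5 * K + 9 * X) / 100 / 100).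
  have : s2 * D <= s2 * ((6 * K + X) / 100) by rewrite ler_pM2l //; lra.
  have : s2 * y <= s2 * (4 * X + K) by rewrite ler_pM2l //; lra.
  lra.
by split=> //; rewrite -(ler_pM2l s20); lra.
Qed.

Section LeaveOneOut.
Context {R : realType} {n k : nat}.

(** All randomness enters through [op_bound e H] and the last hypothesis, which is
    the estimate for the column [H_u] in the directions of the columns of the
    projection [Pu u] computed without that column. Summed over [j], the squared
    norms of these columns give the rank [k]. *)
Lemma leave_one_out (c : {ffun 'I_n -> 'I_k}) (d e T sg2 : R) (H : 'M[R]_n)
    (proj : 'M[R]_n -> 'M[R]_n)
    (M := block_mean c d) (Pu := fun u => proj (M + drop_vertex u H))
    (s2 := (d * n%:R / (2 * k%:R)) ^+ 2) (K := k%:R / n%:R : R) :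
  (0 < n)%N -> (0 < k <= n)%N -> 0 < d -> 0 <= e -> 0 <= T -> 0 <= sg2 ->
  top_eigenprojection_rule k proj -> H^T = H -> op_bound e H ->
  (forall a, (n%:R / (2 * k%:R) : R) <= cluster_size R c a <= 2 * n%:R / k%:R) ->
  e ^+ 2 <= s2 / 100 / 100 -> T * k%:R <= s2 / 100 / 100 ->
  T * k%:R * sg2 <= s2 / 100 / 100 * K ->
  (forall u j, (Pu u *m col u H) j 0 ^+ 2 <=
     T * frob2 (col j (Pu u)) * (sg2 + coherence (Pu u))) ->
  forall u, frob2 (proj (M + H) *m col u H) <= s2 * K / 5.
Proof.
move=> n0 /andP[k0 kn] d0 e0 T0 sg0 rule HT He size he hT hTs conc.
have n0R : 0 < n%:R :> R by rewrite ltr0n.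
have k0R : 0 < k%:R :> R by rewrite ltr0n.
have K0 : 0 < K by rewrite divr_gt0.
pose lo : R := n%:R / (2 * k%:R).
have lo0 : 0 < lo by rewrite divr_gt0 ?mulr_gt0.
pose s := d * lo.
have s0 : 0 < s by rewrite mulr_gt0.
have s2E : s2 = s ^+ 2 by rewrite /s2 /s /lo mulrA.
have s20 : 0 < s2 by rewrite s2E exprn_gt0.
have es : e <= s / 100.
  have : e ^+ 2 <= (s / 100) ^+ 2 by move: he; rewrite s2E; lra.
  by rewrite ler_sqr ?nnegrE // divr_ge0 // ltW.
have loP a : lo <= cluster_size R c a by have /andP[] := size a.
have colM u : frob2 (col u M) <= 8 * (s2 * K).
  rewrite frob2_col_block_mean; have /andP[_ hi] := size (c u).
  have -> : 8 * (s2 * K) = d ^+ 2 * (2 * n%:R / k%:R).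
    by rewrite /s2 /K; field; rewrite !gt_eqF.
  by rewrite ler_wpM2l ?sqr_ge0.
have MHsym (H' : 'M[R]_n) : H'^T = H' -> (M + H')^T = M + H'.
  by move=> H'T; rewrite linearD /= H'T block_mean_sym.
have gap (H' : 'M[R]_n) (H'T : H'^T = H') (H'e : op_bound e H') :=
  block_eigenvalues H'T (ltW d0) lo0 e0 loP H'e.
have gain (H' : 'M[R]_n) (x : 'cV[R]_n) : H'^T = H' -> op_bound e H' ->
    s2 * frob2 (proj (M + H') *m x) <=
      4 * frob2 (proj (M + H') *m ((M + H') *m x)).
  move=> H'T H'e; have [U [lam [bU oP]]] := rule _ (MHsym _ H'T).
  have [lam_hi _] := gap _ _ H' H'T H'e bU.
  have se0 : 0 <= d * lo - e by rewrite -/s; lra.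
  have := top_projection_gain x (MHsym _ H'T) bU oP se0 lam_hi.
  have : s ^+ 2 / 4 <= (d * lo - e) ^+ 2 by rewrite -/s; nra.
  by rewrite s2E => h1 h2; have := frob2_ge0 (proj (M + H') *m x); nra.
set P := proj (M + H).
have [U [lam [bU oP]]] := rule _ (MHsym _ HT).
have [lam_hi lam_lo] := gap _ _ H HT He bU.
have [PP PT _] := oP.
have trP : \tr P = k%:R by apply: (trace_top_projection bU oP).
pose X := coherence P.
have step u : frob2 (P *m col u H) <= s2 * ((5 * K + 9 * X) / 100 / 100) /\
    frob2 (col u P) <= 65 * K + X / 10.
  pose Hu := drop_vertex u H.
  have HuT : Hu^T = Hu by apply: drop_vertex_sym.
  have Hue : op_bound e Hu by apply: op_bound_drop_vertex.
  have [U' [lam' [bU' oP']]] := rule _ (MHsym _ HuT).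
  have [lam'_hi _] := gap _ _ Hu HuT Hue bU'.
  have [PuP PuT _] := oP'; rewrite -/(Pu u) in oP' PuP PuT.
  have trPu : \tr (Pu u) = k%:R by apply: (trace_top_projection bU' oP').
  have colMH : (M + Hu) *m delta_mx u (0 : 'I_1) = col u M.
    rewrite -colE; apply/colP => i; rewrite !mxE eqxx orbT addr0 //.
  (* Row and column [u] of the reduced noise vanish, so the reduced matrix maps
     [e_u] to a column of the block matrix. *)
  have loc : s2 * frob2 (col u (Pu u)) <= 32 * (s2 * K).
    rewrite colE; apply: le_trans (gain _ _ HuT Hue) _; rewrite colMH //.
    by have := frob2_proj (col u M) PuT PuP; have := colM u; lra.
  have sz : frob2 (Pu u *m col u H) <= s2 / 100 / 100 * (K + coherence (Pu u)).
    rewrite frob2_cV.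
    apply: le_trans
      (_ : \sum_j T * frob2 (col j (Pu u)) * (sg2 + coherence (Pu u)) <= _).
      by apply: ler_sum => j _; apply: conc.
    rewrite -mulr_suml -mulr_sumr -frob2_col frob2_trace PuT PuP trPu mulrDr mulrDr.
    by rewrite lerD // ler_wpM2r // coherence_ge0.
  have drop2 := drop_vertex_rank2 u HT He PuT; rewrite -/Hu in drop2.
  have dk : s2 * frob2 (P - Pu u) <= 16 * frob2 (Pu u *m col u H) +
      512 * (s2 / 100 / 100 * K).
    have lam_up (i : 'I_n) : (k <= i)%N -> lam 0 i <= e.
      by move=> ki; apply: le_trans (ler_norm _) (lam_lo i ki).
    have eg : e <= d * lo - e by rewrite -/s; lra.
    have := davis_kahan (MHsym _ HT) (MHsym _ HuT) bU bU' oP oP' lam_up lam'_hi eg.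
    rewrite -/P (frob2_projB PT PP PuT PuP) ?trP ?trPu //.
    have -> : M + H - (M + Hu) = H - Hu by rewrite opprD addrACA subrr add0r.
    have : s ^+ 2 / 4 <= (d * lo - e - e) ^+ 2 by rewrite -/s; nra.
    have := frob2_ge0 (Pu u - P *m Pu u); set F := frob2 (Pu u - _).
    move=> F0 h1 h2; have h3 : s2 / 4 * F <= frob2 ((H - Hu) *m Pu u).
      by apply: le_trans h2; rewrite s2E ler_wpM2r.
    have : e ^+ 2 * frob2 (col u (Pu u)) <= s2 / 100 / 100 * (32 * K).
      apply: le_trans (_ : s2 / 100 / 100 * frob2 (col u (Pu u)) <= _).
        by rewrite ler_wpM2r.
      by lra.
    by lra.
  have D0 (x : 'cV[R]_n) : frob2 ((P - Pu u) *m x) <= frob2 (P - Pu u) * frob2 x.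
    exact: frob2M.
  have y_le : coherence (Pu u) <= 2 * X + 2 * frob2 (P - Pu u).
    apply: coherence_le => [|j].
      by rewrite addr_ge0 ?mulr_ge0 ?coherence_ge0.
    have -> : col j (Pu u) = col j P - (P - Pu u) *m delta_mx j 0.
      by rewrite !colE mulmxBl opprB addrC subrK.
    apply: le_trans (frob2B _ _) _; have := D0 (delta_mx j 0).
    by rewrite frob2_delta mulr1; have := le_coherence P j; rewrite -/X; lra.
  have w_le : frob2 (P *m col u H) <= 2 * frob2 (Pu u *m col u H) +
      2 * (s2 / 100 / 100 * frob2 (P - Pu u)).
    have -> : P *m col u H = Pu u *m col u H + (P - Pu u) *m col u H.
      by rewrite mulmxBl addrC subrK.
    apply: le_trans (frob2D _ _) _; rewrite lerD2l ler_wpM2l //.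
    apply: le_trans (D0 _) _; rewrite mulrC ler_wpM2r //.
    exact: le_trans (op_bound_col u He) he.
  (* The circularity: the column of [P] is bounded by [P *m col u H] again. *)
  have x_le : s2 * frob2 (col u P) <= 64 * (s2 * K) + 8 * frob2 (P *m col u H).
    rewrite colE; apply: le_trans (gain _ _ HT He) _.
    rewrite -colE -/P linearD /= mulmxDr.
    have := frob2D (P *m col u M) (P *m col u H).
    by have := frob2_proj (col u M) PT PP; have := colM u; lra.
  exact: (coherence_bootstrap s20 (ltW K0) (coherence_ge0 _) (coherence_ge0 _)
    sz dk y_le w_le x_le).
have X_le : X <= 65 * K + X / 10.
  apply: coherence_le => [|j]; last by have [] := step j.
  by rewrite addr_ge0 ?mulr_ge0 ?invr_ge0 ?coherence_ge0 ?(ltW K0) // ltW.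
move=> u; have [h _] := step u; apply: le_trans h _.
by rewrite -[leRHS]mulrA ler_wpM2l ?(ltW s20) //; lra.
Qed.

(** Columns of different clusters are at squared distance at least [4 * (s2 * K)]
    before projection. The projection and the noise change this by small
    multiples of [s2 * K], so [s2 * K] is a valid threshold for the square of the
    distance. *)
Lemma projected_columns_separate (c : {ffun 'I_n -> 'I_k}) (d e : R)
    (H : 'M[R]_n) (proj : 'M[R]_n -> 'M[R]_n)
    (M := block_mean c d) (P := proj (M + H))
    (s2 := (d * n%:R / (2 * k%:R)) ^+ 2) (K := k%:R / n%:R : R) :
  (0 < n)%N -> (0 < k)%N -> 0 < d -> 0 <= e ->
  top_eigenprojection_rule k proj -> H^T = H -> op_bound e H ->
  (forall a, n%:R / (2 * k%:R) <= cluster_size R c a) ->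
  e ^+ 2 <= s2 / 100 / 100 ->
  (forall u, frob2 (P *m col u H) <= s2 * K / 5) ->
  forall u v, (frob2 (P *m col u (M + H) - P *m col v (M + H)) <= s2 * K)
    = (c u == c v).
Proof.
move=> n0 k0 d0 e0 rule HT He loP he small u v.
have n0R : 0 < n%:R :> R by rewrite ltr0n.
have k0R : 0 < k%:R :> R by rewrite ltr0n.
have K0 : 0 < K by rewrite divr_gt0.
pose lo : R := n%:R / (2 * k%:R).
have lo0 : 0 < lo by rewrite divr_gt0 ?mulr_gt0.
have BT : (M + H)^T = M + H by rewrite linearD /= HT block_mean_sym.
have [U [lam [bU oP]]] := rule _ BT; rewrite -/P in oP.
have [_ lam_lo] := block_eigenvalues HT (ltW d0) lo0 e0 loP He bU.
have [PP PT _] := oP.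
have s20 : 0 < s2 by rewrite exprn_gt0 // divr_gt0 ?mulr_gt0.
have -> : P *m col u (M + H) - P *m col v (M + H) =
    P *m (col u M - col v M) + (P *m col u H - P *m col v H).
  have colD w : col w (M + H) = col w M + col w H by apply/colP => i; rewrite !mxE.
  by rewrite !colD !mulmxDr mulmxN opprD addrACA.
set N := P *m col u H - _.
have N_le : frob2 N <= 4 / 5 * (s2 * K).
  apply: le_trans (frob2B _ _) _; have := small u; have := small v; lra.
have [cuv|cuv] := eqVneq (c u) (c v).
  have -> : col u M = col v M by apply/colP => i; rewrite !mxE cuv.
  rewrite subrr mulmx0 add0r; apply: le_trans N_le _.
  have : 0 < s2 * K by rewrite mulr_gt0. lra.
apply/negbTE; rewrite -ltNge.
have sz0 w : 0 < cluster_size R c (c w) by apply: lt_le_trans (loP _).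
have [yu Myu fyu] := block_mean_preimage d (lt0r_neq0 (sz0 u)).
have [yv Myv fyv] := block_mean_preimage d (lt0r_neq0 (sz0 v)).
have sep := block_mean_separation d cuv; rewrite -/M in sep Myu Myv.
have sep_ge : 4 * (s2 * K) <= frob2 (col u M - col v M).
  rewrite sep; have -> : 4 * (s2 * K) = d ^+ 2 * (lo + lo).
    by rewrite /s2 /K /lo; field; rewrite !gt_eqF.
  by rewrite ler_wpM2l ?sqr_ge0 // lerD.
pose y := yu - yv.
have y_le : frob2 y <= 8 * K.
  apply: le_trans (frob2B _ _) _; rewrite fyu fyv.
  have inv w : (cluster_size R c (c w))^-1 <= 2 * K.
    have -> : 2 * K = lo^-1 by rewrite /K /lo; field; rewrite !gt_eqF.
    by rewrite lef_pV2 ?posrE.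
  by have := inv u; have := inv v; lra.
have My : M *m y = col u M - col v M by rewrite mulmxBr Myu Myv.
have res : frob2 (M *m y - P *m (M *m y)) <= 4 * (s2 / 100 / 100 * (8 * K)).
  have -> : M *m y - P *m (M *m y) =
      ((M + H) *m y - P *m ((M + H) *m y)) - (H *m y - P *m (H *m y)).
    by rewrite mulmxDl mulmxDr (opprD (P *m (M *m y))) addrACA addrK.
  apply: le_trans (frob2B _ _) _.
  have := top_projection_residual y BT bU oP lam_lo.
  have := frob2_proj_split (H *m y) PT PP; have := frob2_ge0 (P *m (H *m y)).
  have := He y.
  have : e ^+ 2 * frob2 y <= s2 / 100 / 100 * (8 * K).
    by apply: ler_pM => //; rewrite ?sqr_ge0.
  lra.
have spl := frob2_proj_split (M *m y) PT PP.
rewrite My in spl res.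
set Q := P *m (col u M - col v M) in spl res *.
have : frob2 Q <= 2 * frob2 (Q + N) + 2 * frob2 N.
  by have := frob2B (Q + N) N; rewrite addrK.
have : 0 < s2 * K by rewrite mulr_gt0.
lra.
Qed.

End LeaveOneOut.

(** * Product measures and Chernoff's bound *)

Section ProductMeasure.
Context {R : realType} {I T : finType}.
Variable mu : I -> T -> R.

Definition prodE (F : {ffun I -> T} -> R) : R :=
  \sum_(g : {ffun I -> T}) (\prod_i mu i (g i)) * F g.

Lemma eq_prodE F G : F =1 G -> prodE F = prodE G.
Proof. by move=> FG; apply: eq_bigr => g _; rewrite FG. Qed.

Lemma prodE_sum (J : finType) (P : pred J) (F : J -> {ffun I -> T} -> R) :
  prodE (fun g => \sum_(j | P j) F j g) = \sum_(j | P j) prodE (F j).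
Proof.
by rewrite /prodE exchange_big; apply: eq_bigr => g _; rewrite mulr_sumr.
Qed.

Lemma prodED F G : prodE (fun g => F g + G g) = prodE F + prodE G.
Proof. by rewrite -big_split; apply: eq_bigr => g _; rewrite mulrDr. Qed.

Lemma prodEZ a F : prodE (fun g => a * F g) = a * prodE F.
Proof. by rewrite mulr_sumr; apply: eq_bigr => g _; rewrite mulrCA. Qed.

(** Independence of the coordinates. *)
Lemma prodE_prod (F : I -> T -> R) :
  prodE (fun g => \prod_i F i (g i)) = \prod_i \sum_b mu i b * F i b.
Proof.
by rewrite bigA_distr_bigA; apply: eq_bigr => g _; rewrite big_split.
Qed.

Hypothesis mu_ge0 : forall i b, 0 <= mu i b.
Hypothesis mu_sum1 : forall i, \sum_b mu i b = 1.

Lemma le_prodE F G : (forall g, F g <= G g) -> prodE F <= prodE G.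
Proof.
by move=> FG; apply: ler_sum => g _; rewrite ler_wpM2l ?prodr_ge0.
Qed.

Lemma prodE_cst a : prodE (fun _ => a) = a.
Proof.
rewrite -[RHS]mulr1 /prodE -mulr_suml mulrC; congr (_ * _).
by rewrite -bigA_distr_bigA big1.
Qed.

Lemma prodE_ge0 F : (forall g, 0 <= F g) -> 0 <= prodE F.
Proof. by move=> F0; rewrite -(prodE_cst 0); apply: le_prodE. Qed.

Lemma prodE_markov (F : {ffun I -> T} -> R) (t : R) : (forall g, 0 <= F g) -> 0 < t ->
  prodE (fun g => (t <= F g)%R%:R) <= prodE F / t.
Proof.
move=> F0 t0; rewrite mulrC -prodEZ; apply: le_prodE => g.
case: (leP t (F g)) => tF; last by rewrite mulr_ge0 ?invr_ge0 ?(ltW t0).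
by rewrite mulrC ler_pdivlMr ?mul1r.
Qed.

Lemma prodE_union (J : finType) (E : J -> pred {ffun I -> T}) :
  prodE (fun g => [exists j, E j g]%:R) <= \sum_j prodE (fun g => (E j g)%:R).
Proof.
rewrite -(prodE_sum xpredT (fun j g => (E j g)%:R)); apply: le_prodE => g.
case: existsP => [[j Ej]|_]; last by apply: sumr_ge0.
by rewrite (bigD1 j) //= Ej lerDl sumr_ge0.
Qed.

Definition resample (S : pred I) (g h : {ffun I -> T}) : {ffun I -> T} :=
  [ffun i => if S i then h i else g i].

(** Drawing the coordinates in [S] afresh does not change an expectation. This
    serves as Fubini's theorem: for fixed [g], only the coordinates in [S] of
    the argument of [F] remain random. *)
Lemma prodE_resample S F :
  prodE F = prodE (fun g => prodE (fun h => F (resample S g h))).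
Proof.
transitivity (prodE (fun g => prodE (fun _ => F g))).
  by apply: eq_prodE => g; rewrite prodE_cst.
rewrite /prodE; under eq_bigr do rewrite mulr_sumr.
under [RHS]eq_bigr do rewrite mulr_sumr.
rewrite !pair_bigA /=.
(* Exchanging the coordinates in [S] preserves the product of two copies. *)
pose swap (gh : {ffun I -> T} * {ffun I -> T}) :=
  (resample S gh.1 gh.2, resample S gh.2 gh.1).
have swapK : involutive swap.
  by case=> g h; rewrite /swap /=; congr (_, _); apply/ffunP => i; rewrite !ffunE;
    case: (S i).
rewrite (reindex_inj (inv_inj swapK)) /=; apply: eq_bigr => -[g h] _ /=.
rewrite !mulrA; congr (_ * _); rewrite -!big_split; apply: eq_bigr => i _ /=.
by rewrite !ffunE; case: ifP => // _; rewrite mulrC.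
Qed.

(** From [expR x <= (1 - x)^-1], a consequence of [1 - x <= expR (- x)]. *)
Lemma expR_le_quadratic (x : R) : `|x| <= 1 / 2 -> expR x <= 1 + x + 2 * x ^+ 2.
Proof.
rewrite ler_norml => /andP[x1 x2].
have x3 : 0 < 1 - x by lra.
have : expR x * (1 - x) <= 1.
  rewrite -[leRHS](expRxMexpNx_1 x) ler_wpM2l ?expR_ge0 //.
  by have := expR_ge1Dx (- x); lra.
rewrite -ler_pdivlMr // => h; apply: le_trans h _.
rewrite ler_pdivrMr //; have : 0 <= x ^+ 2 * (1 - 2 * x).
  by rewrite mulr_ge0 ?sqr_ge0 //; lra.
by lra.
Qed.

Lemma expR_half_le : expR (1 / 2 : R) <= 2.
Proof.
have := @expR_le_quadratic (1 / 2); rewrite ger0_norm; last by lra.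
by move=> /(_ (lexx _)); lra.
Qed.

(** The coefficients [a] are themselves random, but [a_resample] says that they are
    determined by the coordinates outside [S]. They are normalized so that the
    Laplace transform is only needed at [1]. *)
Section Chernoff.
Variables (S : pred I) (X : I -> T -> R) (v : R) (a : {ffun I -> T} -> I -> R).
Hypothesis X_le1 : forall i b, `|X i b| <= 1.
Hypothesis X_mean : forall i, \sum_b mu i b * X i b = 0.
Hypothesis X_var : forall i, \sum_b mu i b * X i b ^+ 2 <= v.
Hypothesis a_resample : forall g h, a (resample S g h) = a g.
Hypothesis a_le : forall g i, S i -> `|a g i| <= 1 / 2.
Hypothesis a_var : forall g, v * \sum_(i | S i) a g i ^+ 2 <= 1 / 4.

(** Given the coordinates outside [S], the expectation factors, and each factor is
    at most [1 + 2 a^2 v <= expR (2 a^2 v)] since the linear term has mean zero. *)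
Lemma prodE_laplace :
  prodE (fun g => expR (\sum_(i | S i) a g i * X i (g i))) <= 2.
Proof.
rewrite (prodE_resample S) -[leRHS]prodE_cst; apply: le_prodE => g.
pose F i b := if S i then expR (a g i * X i b) else 1.
have -> : prodE (fun h => expR (\sum_(i | S i) a (resample S g h) i *
      X i (resample S g h i))) = prodE (fun h => \prod_i F i (h i)).
  apply: eq_prodE => h; rewrite a_resample expR_sum big_mkcond /=.
  by apply: eq_bigr => i _; rewrite /F ffunE; case: (S i).
rewrite prodE_prod.
apply: le_trans (_ : \prod_i (if S i then expR (2 * (v * a g i ^+ 2)) else 1) <= _).
  apply: ler_prod => i _; apply/andP; split.
    by apply: sumr_ge0 => b _; rewrite mulr_ge0 // /F; case: ifP; rewrite ?expR_ge0.
  rewrite /F; case: ifP => Si; last by under eq_bigr do rewrite mulr1; rewrite mu_sum1.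
  apply: le_trans (_ : 1 + 2 * (v * a g i ^+ 2) <= _); last exact: expR_ge1Dx.
  apply: le_trans (_ : \sum_b (mu i b + a g i * (mu i b * X i b) +
      2 * a g i ^+ 2 * (mu i b * X i b ^+ 2)) <= _).
    apply: ler_sum => b _.
    have -> : mu i b + a g i * (mu i b * X i b) + 2 * a g i ^+ 2 * (mu i b * X i b ^+ 2)
       = mu i b * (1 + (a g i * X i b) + 2 * (a g i * X i b) ^+ 2) by ring.
    rewrite ler_wpM2l // expR_le_quadratic // normrM.
    by rewrite -[leRHS]mulr1 ler_pM ?a_le.
  rewrite !big_split /= -!mulr_sumr mu_sum1 X_mean mulr0 addr0.
  rewrite lerD2l -mulrA ler_wpM2l //.
  by rewrite mulrC ler_wpM2r ?sqr_ge0.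
rewrite -big_mkcond -expR_sum /=.
rewrite -!mulr_sumr; apply: le_trans expR_half_le; rewrite ler_expR.
by have := a_var g; lra.
Qed.
End Chernoff.

Lemma prodE_chernoff (S : pred I) (X : I -> T -> R) (v : R)
    (a : {ffun I -> T} -> I -> R) (t : R) :
  (forall i b, `|X i b| <= 1) -> (forall i, \sum_b mu i b * X i b = 0) ->
  (forall i, \sum_b mu i b * X i b ^+ 2 <= v) ->
  (forall g h, a (resample S g h) = a g) ->
  (forall g i, S i -> `|a g i| <= 1 / 2) ->
  (forall g, v * \sum_(i | S i) a g i ^+ 2 <= 1 / 4) ->
  prodE (fun g => (t <= `|\sum_(i | S i) a g i * X i (g i)|)%R%:R) <= 4 * expR (- t).
Proof.
move=> X1 X0 Xv aS a1 av.
have up := prodE_laplace X1 X0 Xv aS a1 av.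
have dn : prodE (fun g => expR (- \sum_(i | S i) a g i * X i (g i))) <= 2.
  have := @prodE_laplace S X v (fun g i => - a g i) X1 X0 Xv.
  have -> : prodE (fun g => expR (\sum_(i | S i) - a g i * X i (g i))) =
      prodE (fun g => expR (- \sum_(i | S i) a g i * X i (g i))).
    by apply: eq_prodE => g; rewrite -sumrN; under eq_bigr do rewrite mulNr.
  apply => [g h|g i Si|g]; first by rewrite aS.
    by rewrite normrN a1.
  by under eq_bigr do rewrite sqrrN; apply: av.
apply: le_trans (_ : prodE (fun g => expR (- t) *
    (expR (\sum_(i | S i) a g i * X i (g i)) +
     expR (- \sum_(i | S i) a g i * X i (g i)))) <= _).
  apply: le_prodE => g; set y := \sum_(i | S i) _.
  have ey : 0 < expR y := expR_gt0 _; have eNy : 0 < expR (- y) := expR_gt0 _.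
  case: (leP t `|y|) => ty; last by rewrite mulr_ge0 ?addr_ge0 ?expR_ge0.
  rewrite -[leLHS](expRxMexpNx_1 (- t)) opprK ler_wpM2l ?expR_ge0 //.
  have : expR t <= expR `|y| by rewrite ler_expR.
  by case: (lerP 0 y) => y0; [rewrite ger0_norm|rewrite ltr0_norm] => //; lra.
rewrite prodEZ prodED mulrC ler_wpM2r ?expR_ge0 //; lra.
Qed.

End ProductMeasure.

(** * Walks and the operator norm of the noise *)

Section Fresh.
Context {T : finType}.
Implicit Types V s : seq T.

(** The number of distinct entries of [s] outside [V], counted along [s] so that it
    can be followed step by step on a walk. *)
Fixpoint fresh (V s : seq T) : nat :=
  if s is y :: s' then ((y \notin V) + fresh (y :: V) s')%N else 0%N.

Lemma fresh_le_card V s : (fresh V s <= #|[set y in s | y \notin V]|)%N.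
Proof.
elim: s V => [|y s IH] V //=; apply: leq_trans (leq_add (leqnn _) (IH _)) _.
set A := [set z in s | _]; set B := [set z in _ :: _ | _].
have yA : y \notin A by rewrite !inE eqxx andbF.
have AB : A \subset B.
  by apply/subsetP => z; rewrite !inE negb_or => /and3P[-> _ ->]; rewrite orbT.
case: (boolP (y \in V)) => yV; first by rewrite add0n subset_leq_card.
have := cardsU1 y A; rewrite yA => <-; apply: subset_leq_card.
apply/subsetP => z; rewrite in_setU1 => /predU1P[->|/(subsetP AB)//].
by rewrite !inE eqxx.
Qed.

Lemma sum_count_mem s : (\sum_(y : T) count_mem y s)%N = size s.
Proof.
elim: s => [|x s IH] /=; first by rewrite big1.
rewrite big_split /= IH (bigD1 x) //= eqxx big1 ?addn0 // => y.
by rewrite eq_sym => /negbTE ->.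
Qed.

Lemma double_support_le_size s : (forall y, count_mem y s != 1%N) ->
  (2 * #|[set y in s]| <= size s)%N.
Proof.
move=> s2; rewrite -sum_count_mem -sum1_card big_distrr /= big_mkcond /=.
apply: leq_sum => y _; rewrite inE; case: ifP => // ys.
by have := s2 y; move: ys; rewrite -has_pred1 has_count; case: count => [|[]].
Qed.

End Fresh.

Section Walks.
Context {n : nat}.

Definition edge (i j : 'I_n) : 'I_n * 'I_n := if (i <= j)%N then (i, j) else (j, i).

Lemma edgeC i j : edge i j = edge j i.
Proof.
rewrite /edge; case: ltngtP => // ij.
by rewrite (val_inj ij).
Qed.

Lemma edge_ends i j : (edge i j).1 \in [:: i; j] /\ (edge i j).2 \in [:: i; j].
Proof. by rewrite /edge; case: leqP; rewrite !inE !eqxx !orbT. Qed.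

Lemma edge_right i j : (j == (edge i j).1) || (j == (edge i j).2).
Proof. by rewrite /edge; case: leqP; rewrite /= eqxx ?orbT. Qed.

(** A walk reaches a new vertex through a new edge: no earlier edge ends there. *)
Lemma fresh_vertices_le_edges (x : 'I_n) s V E : x \in V ->
  (forall e, e \in E -> (e.1 \in V) && (e.2 \in V)) ->
  (fresh V s <= fresh E (pairmap edge x s))%N.
Proof.
elim: s x V E => [|y s IH] x V E //= xV EV; apply: leq_add.
  case: (boolP (y \in V)) => //= yV; rewrite lt0b.
  apply: contra yV => /EV/andP[e1 e2].
  by case/orP: (edge_right x y) => /eqP ->.
apply: IH => [|e]; first by rewrite inE eqxx.
rewrite inE => /predU1P[->|/EV/andP[e1 e2]]; last by rewrite !inE e1 e2 !orbT.
have [] := edge_ends x y; rewrite !inE => e1 e2; apply/andP.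
by split; [case/orP: e1 => /eqP -> | case/orP: e2 => /eqP ->]; rewrite ?eqxx ?xV ?orbT.
Qed.

Context {R : realType}.

(** Nested sums over the sequences of length [N]: unlike a sum over tuples, they
    unfold along an induction on [N]. *)
Fixpoint sum_seqs (N : nat) (F : seq 'I_n -> R) : R :=
  if N is N'.+1 then \sum_y sum_seqs N' (fun s => F (y :: s)) else F [::].

Lemma le_sum_seqs N F G : (forall s, size s = N -> F s <= G s) ->
  sum_seqs N F <= sum_seqs N G.
Proof.
elim: N F G => [|N IH] F G FG /=; first exact: FG.
by apply: ler_sum => y _; apply: IH => s sN; apply: FG; rewrite /= sN.
Qed.

Lemma sum_seqsZ N a F : sum_seqs N (fun s => a * F s) = a * sum_seqs N F.
Proof.
elim: N F => [|N IH] F //=; rewrite mulr_sumr; apply: eq_bigr => y _.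
exact: IH.
Qed.

Lemma eq_sum_seqs N F G : F =1 G -> sum_seqs N F = sum_seqs N G.
Proof.
elim: N F G => [|N IH] F G FG //=; apply: eq_bigr => y _.
by apply: IH => s; apply: FG.
Qed.

(** Weighting a sequence by [n ^- fresh V s] makes each step cost at most the number
    of vertices seen so far, plus one: the at most [n] new vertices have weight
    [n^-1] each. *)
Lemma sum_seqs_fresh N V : (0 < n)%N ->
  sum_seqs N (fun s => n%:R ^- fresh V s) <= (size V + N)%:R ^+ N.
Proof.
move=> n0; have n0R : 0 < n%:R :> R by rewrite ltr0n.
elim: N V => [|N IH] V /=; first by rewrite !expr0 invr1.
apply: le_trans (_ : \sum_y n%:R ^- (y \notin V) * (size V + N.+1)%:R ^+ N <= _).
  apply: ler_sum => y _.
  have -> : sum_seqs N (fun s => n%:R ^- ((y \notin V) + fresh (y :: V) s)) =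
     n%:R ^- (y \notin V) * sum_seqs N (fun s => n%:R ^- fresh (y :: V) s).
    by rewrite -sum_seqsZ; apply: eq_sum_seqs => s; rewrite exprD invfM.
  by rewrite ler_wpM2l ?invr_ge0 ?exprn_ge0 ?(ltW n0R) // addnS -addSn; apply: IH.
rewrite -mulr_suml exprS ler_wpM2r ?exprn_ge0 //.
apply: le_trans (_ : \sum_y ((y \in V)%:R + n%:R^-1) <= _).
  apply: ler_sum => y _; case: (y \in V) => /=.
    by rewrite expr0 invr1 lerDl invr_ge0 ltW.
  by rewrite expr1 add0r.
rewrite big_split /= sumr_const card_ord -[_^-1 *+ _]mulr_natl mulfV ?gt_eqF //.
have : \sum_(y : 'I_n) (y \in V)%:R <= (size V)%:R :> R.
  by rewrite -natr_sum ler_nat -big_mkcond sum1_card card_size.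
by rewrite !natrD -[N.+1]addn1 natrD; have := ler0n R N; lra.
Qed.

End Walks.

Section TraceMoment.
Context {R : realType} {n : nat}.

Definition mxpow (H : 'M[R]_n) (N : nat) : 'M[R]_n := iter N (mulmx H) 1%:M.

Definition edge_matrix (Y : 'I_n * 'I_n -> R) : 'M[R]_n := \matrix_(i, j) Y (edge i j).

Lemma edge_matrix_sym Y : (edge_matrix Y)^T = edge_matrix Y.
Proof. by apply/matrixP => i j; rewrite !mxE edgeC. Qed.

(** The entries of a matrix power are sums over walks; an edge and its reverse
    carry the same variable. *)
Lemma mxpow_walks Y N x z : mxpow (edge_matrix Y) N x z =
  sum_seqs N (fun s => (last x s == z)%:R * \prod_(e <- pairmap edge x s) Y e).
Proof.
elim: N x => [|N IH] x /=; first by rewrite mxE big_nil mulr1.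
rewrite mxE; apply: eq_bigr => y _; rewrite IH mxE -sum_seqsZ.
by apply: eq_sum_seqs => s; rewrite big_cons mulrCA.
Qed.

Lemma prod_seq_count (I : finType) (Y : I -> R) (s : seq I) :
  \prod_(e <- s) Y e = \prod_e Y e ^+ count_mem e s.
Proof.
elim: s => [|a s IH]; first by rewrite big_nil big1.
rewrite big_cons IH [RHS](eq_bigr (fun e => Y e ^+ (a == e) * Y e ^+ count_mem e s)).
  rewrite big_split /=; congr (_ * _); rewrite (bigD1 a) //= eqxx expr1 big1 ?mulr1 //.
  by move=> e; rewrite eq_sym => /negbTE ->.
by move=> e _; rewrite -exprD.
Qed.

Lemma trace_mxpow H U lam N : H^T = H -> ordered_eigenbasis H U lam ->
  \tr (mxpow H N) = \sum_i lam 0 i ^+ N.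
Proof.
move=> HT bU; have [UU _ _] := bU.
have UN r (x : 'M[R]_(n, r)) i j :
    (U *m (mxpow H N *m x)) i j = lam 0 i ^+ N * (U *m x) i j.
  elim: N => [|N IH] /=; first by rewrite mul1mx mul1r.
  by rewrite -mulmxA (eigenbasis_mulmx_entry _ _ _ HT bU) IH exprS mulrA.
rewrite -[mxpow H N]mulmx1 -(eigenbasis_orth bU) mulmxA mxtrace_mulC.
by apply: eq_bigr => i _; rewrite UN UU mxE eqxx mulr1.
Qed.

(** The trace of an even power dominates the same power of each eigenvalue. *)
Lemma op_bound_of_trace H U lam e m : H^T = H -> ordered_eigenbasis H U lam ->
  (0 < m)%N -> \tr (mxpow H (2 * m)) <= (e ^+ 2) ^+ m -> op_bound e H.
Proof.
move=> HT bU m0; rewrite (trace_mxpow _ HT bU) => tr_le x.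
have lam_le i : lam 0 i ^+ 2 <= e ^+ 2.
  rewrite -(ler_pXn2r m0) ?nnegrE ?sqr_ge0 // -exprM; apply: le_trans tr_le.
  rewrite (bigD1 i) //= lerDl; apply: sumr_ge0 => j _.
  by rewrite exprM exprn_ge0 ?sqr_ge0.
rewrite -(frob2_eigenbasis _ bU) -(frob2_eigenbasis x bU) !frob2_cV mulr_sumr.
apply: ler_sum => i _; rewrite (eigenbasis_mulmx_entry _ _ _ HT bU) exprMn.
by rewrite ler_wpM2r ?sqr_ge0.
Qed.

Context {T : finType}.
Variables (mu X : 'I_n * 'I_n -> T -> R) (v : R).
Hypothesis mu_ge0 : forall e b, 0 <= mu e b.
Hypothesis mu_sum1 : forall e, \sum_b mu e b = 1.
Hypothesis X_le1 : forall e b, `|X e b| <= 1.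
Hypothesis X_mean : forall e, \sum_b mu e b * X e b = 0.
Hypothesis X_var : forall e, \sum_b mu e b * X e b ^+ 2 <= v.

(** The argument only witnesses that there is an edge. *)
Lemma variance_ge0 : ('I_n * 'I_n)%type -> 0 <= v.
Proof.
move=> e; apply: le_trans (X_var e).
by apply: sumr_ge0 => b _; rewrite mulr_ge0 ?sqr_ge0.
Qed.

Lemma moment_le (e : 'I_n * 'I_n) r : (1 < r)%N -> \sum_b mu e b * X e b ^+ r <= v.
Proof.
move=> r1; apply: le_trans (X_var e); apply: ler_sum => b _; rewrite ler_wpM2l //.
apply: le_trans (ler_norm _) _; rewrite normrX -(real_normK (num_real (X e b))).
by rewrite ler_wiXn2l.
Qed.

Lemma moment_ge (e : 'I_n * 'I_n) r : (1 < r)%N -> - v <= \sum_b mu e b * X e b ^+ r.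
Proof.
move=> r1; rewrite lerNl; apply: le_trans (X_var e).
rewrite -sumrN; apply: ler_sum => b _; rewrite -mulrN ler_wpM2l //.
apply: le_trans (ler_norm _) _.
rewrite normrN normrX -(real_normK (num_real (X e b))).
by rewrite ler_wiXn2l.
Qed.

(** An edge used exactly once contributes its mean, which is zero. Any other edge
    contributes a moment of order at least two of a variable bounded by one, hence
    at most its variance. *)
Lemma walk_moment (s : seq ('I_n * 'I_n)) :
  prodE mu (fun g => \prod_(e <- s) X e (g e)) <=
    if [forall e, count_mem e s != 1%N] then v ^+ #|[set e in s]| else 0.
Proof.
rewrite (eq_prodE mu (fun g => prod_seq_count (fun e => X e (g e)) s)).
rewrite (prodE_prod mu (fun e b => X e b ^+ count_mem e s)).
case: forallP => [s2|].
  apply: le_trans (ler_norm _) _; rewrite normr_prod.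
  apply: le_trans (_ : \prod_e (if e \in s then v else 1) <= _); last first.
    by rewrite -big_mkcond prodr_const cardsE.
  apply: ler_prod => e _; rewrite normr_ge0 /=.
  have [c0|c0] := posnP (count_mem e s).
    rewrite c0 (eq_bigr (mu e)) => [|b _]; last by rewrite expr0 mulr1.
    rewrite mu_sum1 normr1; case: ifP => //.
    by rewrite -has_pred1 has_count c0.
  have c1 : (1 < count_mem e s)%N by have := s2 e; move: c0; case: count => [|[]].
  by rewrite -has_pred1 has_count c0 ler_norml moment_le // moment_ge.
move/forallP; rewrite negb_forall => /existsP[e]; rewrite negbK => /eqP e1.
by rewrite (bigD1 e) //= e1 X_mean mul0r.
Qed.

Lemma prodE_sum_seqs N (F : seq 'I_n -> R) (G : seq 'I_n -> {ffun _ -> T} -> R) :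
  prodE mu (fun g => sum_seqs N (fun s => F s * G s g)) =
  sum_seqs N (fun s => F s * prodE mu (G s)).
Proof.
elim: N F G => [|N IH] F G /=; first by rewrite prodEZ.
by rewrite (prodE_sum mu xpredT); apply: eq_bigr => y _; apply: IH.
Qed.

(** A contributing walk of length [2 m] has at most [m] distinct edges, so at most
    [m] new vertices, and its moment is at most [v ^+ f] with [f] the number of new
    vertices. As [1 <= n v], this is at most [(n v) ^+ m * n ^- f], and the weights
    [n ^- f] sum to at most [(2 m + 1) ^+ (2 m)]. Counting so crudely loses a factor
    of order [m] in the operator norm, which is affordable for [m] of order
    [ln n]. *)
Lemma trace_moment m : v <= 1 -> 1 <= n%:R * v ->
  prodE mu (fun g => \tr (mxpow (edge_matrix (fun e => X e (g e))) (2 * m)))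
    <= n%:R * ((n%:R * v) ^+ m * (2 * m).+1%:R ^+ (2 * m)).
Proof.
move=> v1 nv1.
have n0 : (0 < n)%N.
  by case: (posnP n) nv1 => // ->; rewrite mul0r ler10.
have n0R : 0 < n%:R :> R by rewrite ltr0n.
set bd := _ * _ ^+ (2 * m); have -> : n%:R * bd = \sum_(x < n) bd.
  by rewrite sumr_const card_ord mulr_natl.
rewrite (prodE_sum mu xpredT).
apply: ler_sum => x _.
have v0 : 0 <= v by apply: variance_ge0 (x, x).
have -> : prodE mu (fun g => mxpow (edge_matrix (fun e => X e (g e))) (2 * m) x x) =
    sum_seqs (2 * m) (fun s => (last x s == x)%:R *
       prodE mu (fun g => \prod_(e <- pairmap edge x s) X e (g e))).
  rewrite -prodE_sum_seqs; apply: eq_prodE => g; exact: mxpow_walks.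
apply: le_trans (_ : sum_seqs (2 * m)
    (fun s => (n%:R * v) ^+ m * n%:R ^- fresh [:: x] s) <= _).
  apply: le_sum_seqs => s sz /=; set es := pairmap edge x s.
  have esz : size es = (2 * m)%N by rewrite size_pairmap.
  apply: le_trans (_ : (if [forall e, count_mem e es != 1%N]
      then v ^+ #|[set e in es]| else 0) <= _).
    have := walk_moment es.
    case: (last x s == x); rewrite ?mul1r // mul0r => _.
    by case: ifP => // _; rewrite exprn_ge0.
  case: ifP => [/forallP s2|_]; last first.
    by rewrite mulr_ge0 ?invr_ge0 ?exprn_ge0 ?mulr_ge0.
  have dm : (#|[set e in es]| <= m)%N.
    by have := double_support_le_size s2; rewrite esz leq_pmul2l.
  have fr : (fresh [:: x] s <= #|[set e in es]|)%N.
    have := @fresh_vertices_le_edges n x s [:: x] [::].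
    rewrite inE eqxx => /(_ isT) h; apply: leq_trans (h _) _ => //.
    apply: leq_trans (fresh_le_card _ _) _; apply: subset_leq_card.
    by apply/subsetP => e; rewrite !inE andbT.
  set D := #|_| in dm fr *; set f := fresh _ _ in fr *.
  apply: le_trans (_ : v ^+ f <= _).
    by rewrite ler_wiXn2l // v0.
  have -> : v ^+ f = (n%:R * v) ^+ f * n%:R ^- f.
    by rewrite exprMn mulrAC mulfV ?mul1r // expf_neq0 // gt_eqF.
  rewrite ler_wpM2r ?invr_ge0 ?exprn_ge0 //.
  by rewrite ler_weXn2l // (leq_trans fr).
rewrite sum_seqsZ /bd ler_wpM2l ?exprn_ge0 ?mulr_ge0 //.
by have := @sum_seqs_fresh n R (2 * m) [:: x] n0; rewrite [(size _ + _)%N]add1n.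
Qed.

End TraceMoment.

(** * The random graph given the partition *)

Section GraphModel.
Context {R : realType} {n k : nat}.
Variables (p q : R) (c : {ffun 'I_n -> 'I_k}).

(** Pairs below the diagonal are given the value [false] almost surely, which turns
    the law of a symmetric matrix into a product over all pairs. *)
Definition edge_weight (e : 'I_n * 'I_n) (b : bool) : R :=
  if (e.1 <= e.2)%N then
    (if b then edge_prob p q c e.1 e.2 else 1 - edge_prob p q c e.1 e.2)
  else (~~ b)%:R.

Definition edge_noise (e : 'I_n * 'I_n) (b : bool) : R :=
  if (e.1 <= e.2)%N then b%:R - edge_prob p q c e.1 e.2 else 0.

Definition graph_of (g : {ffun 'I_n * 'I_n -> bool}) : 'M[bool]_n :=
  \matrix_(i, j) g (edge i j).

Definition noise (g : {ffun 'I_n * 'I_n -> bool}) : 'M[R]_n :=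
  edge_matrix (fun e => edge_noise e (g e)).

Lemma edge_prob_sym i j : edge_prob p q c i j = edge_prob p q c j i.
Proof. by rewrite /edge_prob eq_sym. Qed.

Lemma edge_sorted (i j : 'I_n) : ((edge i j).1 <= (edge i j).2)%N.
Proof. by rewrite /edge; case: (leqP i j) => /= ij; rewrite // ltnW. Qed.

Lemma edge_prob_edge i j :
  edge_prob p q c (edge i j).1 (edge i j).2 = edge_prob p q c i j.
Proof. by rewrite /edge; case: leqP => //= _; rewrite edge_prob_sym. Qed.

Lemma centered_adjacency_graph g :
  centered_adjacency q (graph_of g) = block_mean c (p - q) + noise g.
Proof.
apply/matrixP => i j; rewrite !mxE /edge_noise edge_sorted edge_prob_edge.
by rewrite /edge_prob; case: ifP => _; ring.
Qed.

(** Symmetric matrices correspond to the families [g] that vanish below the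
    diagonal, and all other families have weight zero. *)
Lemma sum_ussbm_mass (F : pred (outcome n k)) :
  \sum_(A : 'M[bool]_n | F (c, A)) ussbm_mass p q (c, A) =
    k%:R ^- n * prodE edge_weight (fun g => (F (c, graph_of g))%:R).
Proof.
pose P (e : 'I_n * 'I_n) := (e.1 <= e.2)%N.
pose up (A : 'M[bool]_n) : {ffun 'I_n * 'I_n -> bool} := [ffun e => P e && A e.1 e.2].
pose ok (g : {ffun 'I_n * 'I_n -> bool}) := [forall e, g e ==> P e].
rewrite mulr_sumr (bigID ok) /= [X in _ = _ + X]big1 ?addr0; last first.
  move=> g; rewrite negb_forall => /existsP[e]; rewrite negb_imply => /andP[ge Pe].
  by rewrite (bigD1 e) //= /edge_weight -/(P e) (negbTE Pe) ge !mul0r mulr0.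
rewrite /ussbm_mass /= -big_mkcondr /=.
rewrite (reindex_onto graph_of up) /=; last first.
  move=> A /andP[_ /eqP AT]; apply/matrixP => i j; rewrite !mxE ffunE.
  rewrite /P edge_sorted /edge /=; case: leqP => //= _.
  by rewrite -[in LHS]AT mxE.
rewrite big_mkcond [RHS]big_mkcond /=; apply: eq_bigr => g _.
have -> : up (graph_of g) == g = ok g.
  apply/eqP/forallP => [<- e|okg].
    by rewrite ffunE; case: (P e); rewrite ?implybT.
  apply/ffunP => e; rewrite ffunE mxE; have := okg e.
  case Pe: (P e) => /= ge; last by apply/esym/negbTE; move: ge; rewrite implybF.
  by rewrite /edge -/(P (e.1, e.2)) [P _]Pe -surjective_pairing.
have -> : (graph_of g)^T == graph_of g.
  by apply/eqP/matrixP => i j; rewrite !mxE edgeC.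
rewrite andbT; case okg: (ok g); last by rewrite andbF.
rewrite andbT; case: ifP => _; last by rewrite !mulr0.
rewrite mulr1; congr (_ * _); rewrite big_mkcond /=; apply: eq_bigr => e _.
rewrite /edge_weight mxE -/(P e); case Pe: (P e).
  by rewrite /edge -/(P (e.1, e.2)) [P (_, _)]Pe -surjective_pairing.
by move/forallP/(_ e): okg; rewrite Pe implybF => /negbTE ->.
Qed.

Hypotheses (p01 : 0 <= p <= 1) (q01 : 0 <= q <= 1).

Lemma edge_prob01 i j : 0 <= edge_prob p q c i j <= 1.
Proof. by rewrite /edge_prob; case: ifP. Qed.

Lemma edge_weight_ge0 e b : 0 <= edge_weight e b.
Proof.
rewrite /edge_weight; case: ifP => // _; have /andP[h0 h1] := edge_prob01 e.1 e.2.
by case: b => //; rewrite subr_ge0.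
Qed.

Lemma edge_weight_sum1 e : \sum_b edge_weight e b = 1.
Proof. by rewrite big_bool /edge_weight /=; case: ifP => _; rewrite ?add0r //; ring. Qed.

Lemma edge_noise_le1 e b : `|edge_noise e b| <= 1.
Proof.
rewrite /edge_noise; case: ifP => _; last by rewrite normr0.
have /andP[h0 h1] := edge_prob01 e.1 e.2.
by rewrite ler_norml; case: b => /=; lra.
Qed.

Lemma edge_noise_mean e : \sum_b edge_weight e b * edge_noise e b = 0.
Proof. by rewrite big_bool /edge_weight /edge_noise /=; case: ifP => _; ring. Qed.

Lemma edge_noise_var e : \sum_b edge_weight e b * edge_noise e b ^+ 2 <=
  Num.max (p * (1 - p)) (q * (1 - q)).
Proof.
have sg0 : 0 <= Num.max (p * (1 - p)) (q * (1 - q)).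
  by case/andP: p01 => p0 p1; rewrite le_max mulr_ge0 ?subr_ge0.
rewrite big_bool /edge_weight /edge_noise /=; case: ifP => _; last first.
  by rewrite expr0n !mulr0 addr0.
set x := edge_prob _ _ _ _ _.
have -> : x * (1 - x) ^+ 2 + (1 - x) * (0 - x) ^+ 2 = x * (1 - x) by ring.
by rewrite /x /edge_prob le_max; case: ifP; rewrite lexx ?orbT.
Qed.

Definition other_end (u : 'I_n) (e : 'I_n * 'I_n) := if e.1 == u then e.2 else e.1.

(** The pairs of the form [edge u i], written so that they are indexed bijectively by
    [i] through [other_end]. *)
Definition touches (u : 'I_n) : pred ('I_n * 'I_n) :=
  fun e => edge u (other_end u e) == e.

Lemma other_endK u i : other_end u (edge u i) = i.
Proof.
rewrite /other_end /edge; case: leqP => _ /=; first by rewrite eqxx.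
by case: eqP.
Qed.

Lemma sum_touches u (F : 'I_n * 'I_n -> R) :
  \sum_(e | touches u e) F e = \sum_i F (edge u i).
Proof.
rewrite (reindex_onto (edge u) (other_end u)) => [|e /eqP //].
by apply: eq_bigl => i; rewrite /touches other_endK !eqxx.
Qed.

(** Independence of the reduced noise and the edges at [u], in the form that
    [prodE_chernoff] requires. *)
Lemma drop_vertex_noise_resample u g h :
  drop_vertex u (noise (resample (touches u) g h)) = drop_vertex u (noise g).
Proof.
apply/matrixP => i j; rewrite !mxE; case: ifP => // /norP[iu ju].
rewrite ffunE; case: ifP => // /eqP eE.
have := edge_right (other_end u (edge i j)) u; rewrite edgeC eE.
have [] := edge_ends i j; rewrite !inE => e1 e2.
case/orP => /eqP uE; [move: e1|move: e2]; rewrite -uE;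
  by rewrite !(eq_sym u) (negbTE iu) (negbTE ju).
Qed.

(** Chernoff's bound for the scalar product of column [u] of the noise with row [j] of
    [Pu g], a vector which is independent of that column. Since [Pu g] is a
    projection, the entries of its row satisfy [Pu j i ^+ 2 <= V * y], with [V] the
    squared norm of the row and [y] the coherence: this sup bound and the variance
    give the two terms of the scale [V * (sg2 + y)]. *)
Lemma vertex_concentration (proj : 'M[R]_n -> 'M[R]_n) (l : R) u j
    (sg2 := Num.max (p * (1 - p)) (q * (1 - q)))
    (Pu := fun g => proj (block_mean c (p - q) + drop_vertex u (noise g))) :
  top_eigenprojection_rule k proj -> 0 <= l -> 0 < sg2 ->
  prodE edge_weight (fun g =>
    ((36 * l ^+ 2) * frob2 (col j (Pu g)) * (sg2 + coherence (Pu g)) <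
      (Pu g *m col u (noise g)) j 0 ^+ 2)%R%:R) <= 4 * expR (- (3 * l)).
Proof.
move=> rule l0 sg0.
have PuP g : Pu g *m Pu g = Pu g /\ (Pu g)^T = Pu g.
  have [|U [lam [_ [PP PT _]]]] := rule (block_mean c (p - q) + drop_vertex u (noise g)).
    by rewrite linearD /= block_mean_sym drop_vertex_sym // edge_matrix_sym.
  by split.
pose V g := frob2 (col j (Pu g)); pose y g := coherence (Pu g).
(* The normalization at which Chernoff's bound applies. If [V g = 0], then
   [th g = 0] because the inverse of [0] is [0], and the scalar product
   vanishes. *)
pose th g : R := (2 * Num.sqrt (V g * (sg2 + y g)))^-1.
pose a g (e : 'I_n * 'I_n) := th g * Pu g j (other_end u e).
have V0 g : 0 <= V g by rewrite /V.
have sy0 g : 0 < sg2 + y g by rewrite ltr_wpDr ?coherence_ge0.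
have Vy0 g : 0 <= V g * (sg2 + y g) by rewrite mulr_ge0 // ltW.
have th0 g : 0 <= th g by rewrite invr_ge0 mulr_ge0 ?sqrtr_ge0.
have th2 g : th g ^+ 2 * (V g * (sg2 + y g)) <= 1 / 4.
  rewrite /th exprVn exprMn sqr_sqrtr //.
  have [->|V1] := eqVneq (V g * (sg2 + y g)) 0; first by rewrite mulr0 divr_ge0.
  rewrite invfM divfK //; have -> : (2 ^+ 2)^-1 = 1 / 4 :> R by field.
  by [].
have Pentry g i : Pu g j i ^+ 2 <= V g * y g.
  have [PP PT] := PuP g; rewrite -[in leLHS]PP mxE.
  apply: le_trans (sum_cauchy_schwarz _ _) _.
  apply: ler_pM; try by apply: sumr_ge0 => l' _; apply: sqr_ge0.
    rewrite /V frob2_cV; apply: ler_sum => l' _.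
    by rewrite [col _ _ _ _]mxE -[in leRHS]PT mxE.
  apply: le_trans (le_coherence _ i); rewrite frob2_cV; apply: ler_sum => l' _.
  by rewrite mxE.
apply: le_trans (_ : prodE edge_weight (fun g =>
   (3 * l <= `|\sum_(e | touches u e) a g e * edge_noise e (g e)|)%R%:R) <= _).
  apply: (le_prodE edge_weight_ge0) => g.
  rewrite sum_touches.
  have -> : \sum_i a g (edge u i) * edge_noise (edge u i) (g (edge u i)) =
      th g * (Pu g *m col u (noise g)) j 0.
    rewrite mxE mulr_sumr; apply: eq_bigr => i _; rewrite /a other_endK -mulrA.
    by rewrite [col _ _ _ _]mxE [noise _ _ _]mxE (edgeC i u).
  set w := (Pu g *m _) j 0; case: ltP => // bad.
  rewrite ler_nat lt0b -ler_sqr ?nnegrE ?mulr_ge0 // real_normK ?num_real //.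
  have Vpos : 0 < V g.
    rewrite lt_neqAle V0 andbT eq_sym; apply: contraTneq bad => V00.
    rewrite -/(V g) V00 mulr0 mul0r -leNgt.
    have -> : w = 0; last by rewrite expr0n.
    rewrite /w mxE big1 // => i _; have := Pentry g i; rewrite V00 mul0r => P0.
    have /eqP : Pu g j i ^+ 2 == 0 by rewrite eq_le P0 sqr_ge0.
    by move/eqP; rewrite sqrf_eq0 => /eqP ->; rewrite mul0r.
  have VS : 0 < V g * (sg2 + y g) by rewrite mulr_gt0.
  rewrite [leRHS]exprMn /th exprVn (exprMn _ 2 (Num.sqrt _)).
  rewrite sqr_sqrtr ?(ltW VS) // [leRHS]mulrC.
  rewrite ler_pdivlMr ?mulr_gt0 ?exprn_gt0 //; apply: le_trans (ltW bad).
  by rewrite -/(V g) -/(y g); lra.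
apply: (prodE_chernoff (v := sg2) edge_weight_ge0 edge_weight_sum1 _ edge_noise_le1
  edge_noise_mean edge_noise_var).
- by move=> g h; rewrite /a /th /V /y /Pu drop_vertex_noise_resample.
- move=> g e _; rewrite -ler_sqr ?nnegrE ?divr_ge0 // real_normK ?num_real // /a exprMn.
  apply: le_trans (_ : th g ^+ 2 * (V g * (sg2 + y g)) <= _).
    rewrite ler_wpM2l ?sqr_ge0 //; apply: le_trans (Pentry _ _) _.
    by rewrite ler_wpM2l // lerDr ltW.
  by apply: le_trans (th2 g) _; lra.
- move=> g; rewrite sum_touches; apply: le_trans (th2 g).
  under eq_bigr do rewrite /a other_endK exprMn.
  rewrite -mulr_sumr mulrCA ler_wpM2l ?sqr_ge0 //.
  have -> : \sum_i Pu g j i ^+ 2 = V g.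
    have [_ PT] := PuP g; rewrite /V frob2_cV; apply: eq_bigr => i _.
    by rewrite [col _ _ _ _]mxE -[in RHS]PT mxE.
  by rewrite mulrC ler_wpM2l // lerDl coherence_ge0.
Qed.

End GraphModel.

(** * Sizes of the clusters *)

Section ClusterSizes.
Context {R : realType} {n k : nat}.
Hypothesis k_gt0 : (0 < k)%N.

Definition uniform_weight (i : 'I_n) (a : 'I_k) : R := k%:R^-1.

Definition balanced (c : {ffun 'I_n -> 'I_k}) : bool :=
  [forall a, (n%:R / (2 * k%:R) : R) <= cluster_size R c a <= 2 * n%:R / k%:R].

Lemma uniform_weight_ge0 i a : 0 <= uniform_weight i a.
Proof. by rewrite invr_ge0. Qed.

Lemma uniform_weight_sum1 i : \sum_a uniform_weight i a = 1.
Proof.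
by rewrite /uniform_weight sumr_const card_ord -[LHS]mulr_natl mulfV // pnatr_eq0 -lt0n.
Qed.

Lemma prodE_uniform (F : {ffun 'I_n -> 'I_k} -> R) :
  prodE uniform_weight F = \sum_c k%:R ^- n * F c.
Proof.
by apply: eq_bigr => c _; rewrite prodr_const card_ord exprVn.
Qed.

(** The deviation of a cluster size is [n / (2 k)] at most outside an event that
    Chernoff's bound controls, at the scale [sqrt (n / k)] of its fluctuations;
    the union bound over the clusters costs the factor [k]. *)
Lemma unbalanced_small (l : R) : 1 <= l -> 64 * l ^+ 2 * k%:R <= n%:R ->
  prodE uniform_weight (fun c => (~~ balanced c)%:R) <= k%:R * (4 * expR (- (2 * l))).
Proof.
move=> l1 nl; have l0 : 0 < l by lra.
have k0 : 0 < k%:R :> R by rewrite ltr0n.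
have l2 : 0 < l ^+ 2 by rewrite exprn_gt0.
have n0 : 0 < n%:R :> R by apply: lt_le_trans nl; rewrite !mulr_gt0.
pose th : R := Num.sqrt (k%:R / (4 * n%:R)).
have th2 : th ^+ 2 = k%:R / (4 * n%:R).
  by rewrite sqr_sqrtr // ltW // divr_gt0 // mulr_gt0.
have th0 : 0 < th by rewrite sqrtr_gt0 divr_gt0 // mulr_gt0.
pose X (a : 'I_k) (i : 'I_n) (b : 'I_k) : R := (b == a)%:R - k%:R^-1.
have kV : 0 < (k%:R^-1 : R) <= 1.
  by rewrite invr_gt0 k0 invf_le1 // ler1n.
have /andP[kV0 kV1] := kV.
have sumI a (f : bool -> R) : \sum_(b : 'I_k) k%:R^-1 * f (b == a) =
    k%:R^-1 * f true + (1 - k%:R^-1) * f false.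
  rewrite (bigD1 a) //= eqxx; congr (_ + _).
  rewrite (eq_bigr (fun _ => k%:R^-1 * f false)) => [|b /negbTE -> //].
  rewrite sumr_const cardC1 card_ord -[LHS]mulr_natl mulrA; congr (_ * _).
  by rewrite -subn1 natrB // mulrBl mulfV ?gt_eqF // mul1r.
have tail a : prodE uniform_weight (fun c =>
    (2 * l <= `|\sum_(i | xpredT i) th * X a i (c i)|)%R%:R) <= 4 * expR (- (2 * l)).
  apply: (prodE_chernoff (v := k%:R^-1) (a := fun _ _ => th)
     uniform_weight_ge0 uniform_weight_sum1) => //.
  - by move=> i b; rewrite /X ler_norml; case: (b == a) => /=; lra.
  - by move=> i; rewrite /uniform_weight /X (sumI a (fun x => x%:R - k%:R^-1)) /=; ring.
  - move=> i; rewrite /uniform_weight /X (sumI a (fun x => (x%:R - k%:R^-1) ^+ 2)) /=.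
    by set x := k%:R^-1 in kV0 kV1 *; nra.
  - move=> _ _ _; rewrite -ler_sqr ?nnegrE ?divr_ge0 ?normr_ge0 //.
    rewrite real_normK ?num_real // th2.
    rewrite ler_pdivrMr ?mulr_gt0 //.
    have : 1 <= k%:R :> R by rewrite ler1n.
    suff : k%:R <= n%:R :> R by lra.
    apply: le_trans nl; rewrite -[leLHS]mul1r ler_wpM2r ?(ltW k0) //.
    have : 1 <= l ^+ 2 by rewrite exprn_ege1.
    by lra.
  - move=> _; rewrite sumr_const card_ord th2 -[X in _ * X]mulr_natl.
    rewrite (_ : k%:R^-1 * _ = 1 / 4) //; field.
    by rewrite !gt_eqF.
apply: le_trans (_ : prodE uniform_weight (fun c => [exists a,
   2 * l <= `|\sum_(i | xpredT i) th * X a i (c i)|]%:R) <= _); last first.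
  apply: le_trans (prodE_union uniform_weight_ge0 _) _.
  have -> : k%:R * (4 * expR (- (2 * l))) = \sum_(a < k) 4 * expR (- (2 * l)).
    by rewrite sumr_const card_ord [LHS]mulr_natl.
  apply: ler_sum => a _.
  exact: tail.
apply: (le_prodE uniform_weight_ge0) => c; rewrite ler_nat.
case: (boolP (balanced c)) => //= nb; rewrite lt0b.
move: nb; rewrite negb_forall => /existsP[a na]; apply/existsP; exists a.
move: na; apply: contraR; rewrite -ltNge -mulr_sumr sumrB -cluster_sizeE.
rewrite sumr_const card_ord -[X in _ - X]mulr_natl => dev.
set sz := cluster_size R c a in dev *.
have : `|sz - n%:R / k%:R| <= n%:R / (2 * k%:R).
  rewrite -(ler_pM2l th0) -[th in leLHS]ger0_norm ?(ltW th0) // -normrM.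
  apply: le_trans (ltW dev) _.
  rewrite -ler_sqr ?nnegrE ?mulr_ge0 ?(ltW th0) ?(ltW l0) ?invr_ge0 ?mulr_ge0 //.
  rewrite [leRHS]exprMn th2.
  have -> : k%:R / (4 * n%:R) * (n%:R / (2 * k%:R)) ^+ 2 = n%:R / (16 * k%:R) :> R.
    by field; rewrite !gt_eqF.
  by rewrite ler_pdivlMr ?mulr_gt0 //; lra.
have -> : n%:R / k%:R = 2 * (n%:R / (2 * k%:R)) :> R by field; rewrite gt_eqF.
have -> : 2 * n%:R / k%:R = 4 * (n%:R / (2 * k%:R)) :> R by field; rewrite gt_eqF.
have : 0 < n%:R / (2 * k%:R) :> R by rewrite divr_gt0 // mulr_gt0.
by rewrite ler_norml => h /andP[h1 h2]; apply/andP; split; lra.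
Qed.

End ClusterSizes.

(** * Recovery of the clusters *)

Section Recovery.
Context {R : realType} {n k : nat}.

Lemma l2norm_le (x : 'cV[R]_n) (D2 : R) : 0 <= D2 ->
  (l2norm x <= Num.sqrt D2) = (frob2 x <= D2).
Proof. by move=> D0; rewrite frob2_cV /l2norm ler_sqrt. Qed.

(** A nonempty hidden cluster is the set formed around any of its vertices; an empty
    one would never be formed, so no cluster may be empty. *)
Lemma recovers_of_put_together (proj : 'M[R]_n -> 'M[R]_n) (q Delta : R)
    (c : {ffun 'I_n -> 'I_k}) A :
  (forall u v, put_together proj q Delta A u v = (c u == c v)) ->
  (forall a, exists u, c u = a) -> recovers proj q Delta (c, A).
Proof.
move=> pt surj; apply/eqP/setP => B; apply/imsetP/imsetP => -[].
  move=> u _ ->; exists (c u) => //; apply/setP => v.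
  by rewrite !inE pt eq_sym.
move=> a _ ->; have [u <-] := surj a; exists u => //; apply/setP => v.
by rewrite !inE pt eq_sym.
Qed.

End Recovery.

Section Assembly.
Context {R : realType} {n k : nat}.

Lemma ln_ge1 (N : nat) : (4 <= N)%N -> 1 <= ln (N%:R : R).
Proof.
move=> N4; have N0 : 0 < N%:R :> R by rewrite ltr0n; lia.
rewrite -ler_expR lnK ?posrE //; apply: le_trans (_ : 4 <= _); last by rewrite ler_nat.
have -> : 1 = 1 / 2 + 1 / 2 :> R by field.
rewrite expRD; have := @expR_half_le R; have := expR_gt0 (1 / 2 : R); nra.
Qed.

(** The length [2 m] of the walks: [2 ^ m] must reach [n], so that in the [2 m]-th
    root the factors [n] of the trace and of Markov's inequality cost only a
    constant. *)
Lemma log2_le_ln (N : nat) : (4 <= N)%N ->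
  exists m : nat, [/\ (0 < m)%N, (N <= 2 ^ m)%N & (2 * m).+1%:R <= 7 * ln (N%:R : R)].
Proof.
move=> N4; have N0 : 0 < N%:R :> R by rewrite ltr0n; lia.
exists (up_log 2 N); have m0 : (0 < up_log 2 N)%N by rewrite up_log_gt0 //; lia.
split=> //; first exact: up_logP.
have N1 : (1 < N)%N by lia.
have := @up_log_gtn 2 N isT N1; case: (up_log 2 N) m0 => // m _ /=.
move=> lt2; have l1 := ln_ge1 N4.
have : m%:R * (1 / 2) <= ln (N%:R : R).
  rewrite -ler_expR lnK ?posrE // expRM_natl; apply: le_trans (_ : 2 ^+ m <= _).
    by rewrite lerXn2r ?nnegrE ?expR_ge0 // expR_half_le.
  by rewrite -natrX ler_nat ltnW.
have -> : ((2 * m.+1).+1 = 2 * m + 3)%N by lia.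
by rewrite natrD natrM; lra.
Qed.

(** The exceptional events are a large trace, of probability at most [1 / n] by
    Markov's inequality, and a failure of [vertex_concentration] for one of the
    [n ^ 2] pairs of vertices, each of probability at most [4 / n ^ 3]. *)
Lemma recovery_given_partition (p q l : R) (c : {ffun 'I_n -> 'I_k}) (m : nat)
    (proj : 'M[R]_n -> 'M[R]_n)
    (sg2 := Num.max (p * (1 - p)) (q * (1 - q)))
    (s2 := ((p - q) * n%:R / (2 * k%:R)) ^+ 2) (K := k%:R / n%:R : R) :
  0 <= q -> q < p -> p <= 1 -> (0 < k <= n)%N -> balanced (R := R) c ->
  top_eigenprojection_rule k proj ->
  0 <= l -> n%:R = expR l -> (0 < m)%N -> (n <= 2 ^ m)%N -> (2 * m).+1%:R <= 7 * l ->
  1 <= n%:R * sg2 ->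
  196 * l ^+ 2 * (n%:R * sg2) <= s2 / 100 / 100 ->
  36 * l ^+ 2 * k%:R <= s2 / 100 / 100 ->
  36 * l ^+ 2 * k%:R * sg2 <= s2 / 100 / 100 * K ->
  1 - 5 / n%:R <= prodE (edge_weight p q c) (fun g =>
    (recovers proj q (Num.sqrt (s2 * K)) (c, graph_of g))%:R).
Proof.
move=> q0 qp p1 /andP[k0 kn] bal rule l0 nE m0 nm ml nsg he hT hTs.
have n0 : (0 < n)%N by apply: leq_trans kn.
have n0R : 0 < n%:R :> R by rewrite ltr0n.
have k0R : 0 < k%:R :> R by rewrite ltr0n.
have d0 : 0 < p - q by rewrite subr_gt0.
have p01 : 0 <= p <= 1 by apply/andP; split=> //; lra.
have q01 : 0 <= q <= 1 by apply/andP; split=> //; lra.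
have mu0 := edge_weight_ge0 c p01 q01.
have mu1 := edge_weight_sum1 p q c.
have sg0 : 0 < sg2.
  by rewrite -(pmulr_rgt0 _ n0R); apply: lt_le_trans nsg.
have sg1 : sg2 <= 1 by rewrite ge_max; apply/andP; split; nra.
have s20 : 0 < s2 by rewrite exprn_gt0 // divr_gt0 ?mulr_gt0.
have K0 : 0 < K by rewrite divr_gt0.
pose e : R := Num.sqrt (196 * l ^+ 2 * (n%:R * sg2)).
have e0 : 0 <= e by rewrite sqrtr_ge0.
have e2 : e ^+ 2 = 196 * l ^+ 2 * (n%:R * sg2).
  by rewrite sqr_sqrtr // mulr_ge0 ?mulr_ge0 ?sqr_ge0 // ltW.
pose bd : R := n%:R * ((n%:R * sg2) ^+ m * (2 * m).+1%:R ^+ (2 * m)).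
have bd0 : 0 < bd by rewrite !mulr_gt0 ?exprn_gt0 ?mulr_gt0.
pose H g : 'M[R]_n := noise p q c g.
pose tr g := \tr (mxpow (H g) (2 * m)).
have HT g : (H g)^T = H g by apply: edge_matrix_sym.
have tr0 g : 0 <= tr g.
  have [U [lam [bU _]]] := rule _ (HT g).
  rewrite /tr (trace_mxpow _ (HT g) bU); apply: sumr_ge0 => i _.
  by rewrite exprM exprn_ge0 // sqr_ge0.
have tail_norm :
    prodE (edge_weight p q c) (fun g => (n%:R * bd <= tr g)%R%:R) <= 1 / n%:R.
  have nbd0 : 0 < n%:R * bd by apply: mulr_gt0.
  apply: le_trans (prodE_markov mu0 tr0 nbd0) _.
  rewrite ler_pdivrMr // mulrA divfK ?gt_eqF // mul1r.
  exact: (trace_moment mu0 mu1 (edge_noise_le1 c p01 q01) (edge_noise_mean p q c)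
    (edge_noise_var q c p01) m sg1 nsg).
have norm_ok g : tr g < n%:R * bd -> op_bound e (H g).
  move=> trg; have [U [lam [bU _]]] := rule _ (HT g).
  apply: (op_bound_of_trace (HT g) bU m0); apply: le_trans (ltW trg) _.
  (* The factor [4 ^+ m] absorbs [n ^+ 2], and [(7 * l) ^+ (2 * m)] absorbs the
     number of walks. *)
  have -> : e ^+ 2 = 4 * (7 * l) ^+ 2 * (n%:R * sg2) by rewrite e2; ring.
  rewrite exprMn exprMn /bd -exprM.
  have -> : n%:R * (n%:R * ((n%:R * sg2) ^+ m * (2 * m).+1%:R ^+ (2 * m))) =
     n%:R ^+ 2 * (2 * m).+1%:R ^+ (2 * m) * (n%:R * sg2) ^+ m :> R by ring.
  rewrite ler_wpM2r ?exprn_ge0 ?mulr_ge0 ?(ltW sg0) //.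
  rewrite ler_pM ?exprn_ge0 //.
    have -> : 4 ^+ m = (2 ^+ m) ^+ 2 :> R by rewrite exprAC; congr (_ ^+ _); ring.
    by rewrite lerXn2r ?nnegrE ?exprn_ge0 // -natrX ler_nat.
  by rewrite lerXn2r ?nnegrE ?mulr_ge0.
pose Pu u g := proj (block_mean c (p - q) + drop_vertex u (H g)).
pose bad (uj : 'I_n * 'I_n) g := (36 * l ^+ 2) * frob2 (col uj.2 (Pu uj.1 g)) *
  (sg2 + coherence (Pu uj.1 g)) < (Pu uj.1 g *m col uj.1 (H g)) uj.2 0 ^+ 2.
have tail_vertex :
    prodE (edge_weight p q c) (fun g => [exists uj, bad uj g]%:R) <= 4 / n%:R.
  apply: le_trans (prodE_union mu0 _) _.
  apply: le_trans (_ : \sum_(uj : 'I_n * 'I_n) 4 * expR (- (3 * l)) <= _).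
    by apply: ler_sum => uj _; apply: (vertex_concentration c p01 q01).
  rewrite sumr_const card_prod card_ord -[leLHS]mulr_natl expRN.
  have -> : expR (3 * l) = n%:R ^+ 3 by rewrite nE -expRM_natl.
  rewrite natrM le_eqVlt; apply/orP; left; apply/eqP; field.
  by rewrite gt_eqF.
have good g : ~~ (n%:R * bd <= tr g) -> ~~ [exists uj, bad uj g] ->
    recovers proj q (Num.sqrt (s2 * K)) (c, graph_of g).
  rewrite -ltNge => /norm_ok He; rewrite negb_exists => /forallP ok.
  have /forallP size := bal.
  have conc u j : (Pu u g *m col u (H g)) j 0 ^+ 2 <=
      (36 * l ^+ 2) * frob2 (col j (Pu u g)) * (sg2 + coherence (Pu u g)).
    by have := ok (u, j); rewrite -leNgt.
  have T0 : 0 <= 36 * l ^+ 2 by rewrite mulr_ge0 ?sqr_ge0.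
  have e2s : e ^+ 2 <= s2 / 100 / 100 by rewrite e2.
  have kkn : (0 < k <= n)%N by rewrite k0.
  have small := leave_one_out n0 kkn d0 e0 T0 (ltW sg0) rule (HT g) He size e2s hT hTs conc.
  apply: recovers_of_put_together => [u v|a].
    rewrite /put_together (centered_adjacency_graph p q c) l2norm_le //; last first.
      by apply: mulr_ge0; apply: ltW.
    have loP a : n%:R / (2 * k%:R) <= cluster_size R c a by have /andP[] := size a.
    exact: (projected_columns_separate n0 k0 d0 e0 rule (HT g) He loP e2s small).
  have : 0 < cluster_size R c a.
    have /andP[+ _] := size a; apply: lt_le_trans.
    by rewrite divr_gt0 ?mulr_gt0.
  rewrite ltr0n card_gt0 => /set0Pn[u]; rewrite inE => /eqP <-; by exists u.
have : prodE (edge_weight p q c) (fun _ => 1) <= prodE (edge_weight p q c) (fun g =>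
    (recovers proj q (Num.sqrt (s2 * K)) (c, graph_of g))%:R +
    ((n%:R * bd <= tr g)%R%:R + [exists uj, bad uj g]%:R)).
  apply: (le_prodE mu0) => g.
  case: (boolP (_ <= tr g)) => [_|h1]; first by rewrite addrCA lerDl addr_ge0.
  case: (boolP [exists uj, _]) => [_|h2]; first by rewrite add0r lerDr.
  by rewrite good //= lerDl addr_ge0.
rewrite prodE_cst // !prodED; lra.
Qed.

End Assembly.

(** First draw the partition, then the graph. *)
Lemma ussbm_PrE (R : realType) (n k : nat) (p q : R) (E : pred (outcome n k)) :
  ussbm_Pr p q E = prodE (fun (_ : 'I_n) (_ : 'I_k) => k%:R^-1) (fun c =>
    prodE (edge_weight p q c) (fun g => (E (c, graph_of g))%:R)).
Proof.
rewrite (prodE_uniform (n := n) (k := k)) /ussbm_Pr.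
under [RHS]eq_bigr do rewrite -sum_ussbm_mass big_mkcond.
rewrite big_mkcond pair_bigA /=; apply: eq_bigr => -[c A] _ //.
Qed.

(** The consequences of the lower bound on [n] that the proof uses, with [l = ln n].
    That bound reads [(2 s) ^+ 2 >= 100 ^+ 4 * l ^+ 14 * p (1 - q) * n] in terms of
    the signal eigenvalue [s], and [p (1 - q)] dominates both the variance and
    [(p - q) / 4]. *)
Lemma parameter_regime (R : realType) (p q l n k : R)
    (sg2 := Num.max (p * (1 - p)) (q * (1 - q)))
    (s2 := ((p - q) * n / (2 * k)) ^+ 2) (K := k / n) :
  0 <= q -> q < p -> p <= 3 / 4 -> 1 <= l -> 1 <= k -> 0 < n ->
  100 ^+ 4 * l ^+ 14 * (p * (1 - q)) * k ^+ 2 / (p - q) ^+ 2 <= n ->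
  [/\ 196 * l ^+ 2 * (n * sg2) <= s2 / 100 / 100,
      36 * l ^+ 2 * k <= s2 / 100 / 100,
      36 * l ^+ 2 * k * sg2 <= s2 / 100 / 100 * K
    & 64 * l ^+ 2 * k <= n].
Proof.
move=> q0 qp p34 l1 k1 n0; set L := l ^+ 2; set d := p - q.
have d0 : 0 < d by rewrite subr_gt0.
have dp : d <= p by rewrite /d; lra.
have d1 : d <= 1 by rewrite /d; lra.
have l0 : 0 < l by lra.
have k0 : 0 < k by lra.
have L1 : 1 <= L by rewrite exprn_ege1.
have L14 : L <= l ^+ 14 by rewrite ler_weXn2l.
set w := p * (1 - q).
have wd : d <= 4 * w by rewrite /w; nra.
have w0 : 0 < w by lra.
have sgw : sg2 <= w by rewrite ge_max /w; apply/andP; split; nra.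
rewrite ler_pdivrMr ?exprn_gt0 // => hyp.
have A : 100 * 100 * 100 * 100 * (L * w * k ^+ 2) <= n * d ^+ 2.
  apply: le_trans hyp.
  have -> : 100 ^+ 4 * l ^+ 14 * w * k ^+ 2 =
    100 * 100 * 100 * 100 * (l ^+ 14 * w * k ^+ 2) by ring.
  apply: ler_wpM2l; first by rewrite !mulr_ge0.
  by do 2 (apply: ler_wpM2r; first by rewrite ?sqr_ge0 // ltW).
have s2E : s2 = n * (n * d ^+ 2) / (4 * k ^+ 2).
  by rewrite /s2 -/d; field; rewrite gt_eqF.
have B : 100 * 100 * 100 * 25 * (L * w * n) <= s2.
  rewrite s2E ler_pdivlMr ?mulr_gt0 ?exprn_gt0 //.
  have -> : 100 * 100 * 100 * 25 * (L * w * n) * (4 * k ^+ 2) =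
    n * (100 * 100 * 100 * 100 * (L * w * k ^+ 2)) by ring.
  by rewrite ler_wpM2l // ltW.
have D : 100 * 100 * 100 * 25 * (L * k ^+ 2) <= n * d.
  rewrite -(ler_pM2r d0); apply: le_trans (_ : n * d ^+ 2 <= _).
    apply: le_trans A; have : L * k ^+ 2 * d <= L * k ^+ 2 * (4 * w).
      by rewrite ler_wpM2l ?mulr_ge0 ?exprn_ge0 // ltW.
    by lra.
  by rewrite expr2 mulrA.
have kk : k <= k ^+ 2 by rewrite expr2 ler_peMl // ltW.
have Lk : k <= L * k ^+ 2.
  by apply: le_trans kk _; rewrite ler_peMl ?exprn_ge0 // ltW.
have LkL : L * k <= L * k ^+ 2 by rewrite ler_wpM2l //; lra.
have nd : n * d <= n by rewrite ler_piMr // ltW.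
have Lwn : L * (n * sg2) <= L * w * n.
  by rewrite -mulrA ler_wpM2l ?(mulrC w) //; [lra | rewrite ler_wpM2l // ltW].
split.
- have -> : 196 * L * (n * sg2) = 196 * (L * (n * sg2)) by ring.
  have : 0 <= L * w * n by rewrite !mulr_ge0 ?ltW //; lra.
  by lra.
- have : L * k <= L * w * n.
    rewrite -mulrA ler_wpM2l //; first lra.
    have : n * d <= n * (4 * w) by rewrite ler_wpM2l // ltW.
    by lra.
  have : 0 <= L * k by rewrite mulr_ge0 //; lra.
  by lra.
- rewrite /K mulrA ler_pdivlMr //.
  have -> : 36 * L * k * sg2 * n = 36 * (L * (n * sg2)) * k by ring.
  rewrite ler_wpM2r ?(ltW k0) //.
  have : 0 <= L * w * n by rewrite !mulr_ge0 ?ltW //; lra.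
  by lra.
- by lra.
Qed.

Theorem theorem1p3 (R : realType) :
  exists C0 C1 C2 : R, [/\ 0 < C0, 0 < C1, 0 < C2 &
    forall (n k : nat) (p q : R),
      (0 < n)%N -> (0 < k)%N ->
      0 <= q -> p <= 3 / 4 -> q <= 3 / 4 -> q < p ->
      C0 * ln (n%:R : R) / n%:R <= Num.max (p * (1 - p)) (q * (1 - q)) ->
      C1 * ln (n%:R : R) ^+ 14 * (p * (1 - q)) * k%:R ^+ 2 / (p - q) ^+ 2
        <= n%:R ->
      exists2 Delta : R, 0 < Delta &
        forall proj : 'M[R]_n -> 'M[R]_n,
          top_eigenprojection_rule k proj ->
          1 - C2 / n%:R
            <= ussbm_Pr p q (@recovers R n k proj q Delta)].
Proof.
(* Of the [9] units of failure probability [1 / n], [5] come from the graph and [4]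
   from the partition. *)
exists 1, (100 ^+ 4), 9; split=> //; first by rewrite exprn_gt0.
move=> n k p q n0 k0 q0 p34 q34 qp hsg hn.
have n0R : 0 < n%:R :> R by rewrite ltr0n.
have k0R : 0 < k%:R :> R by rewrite ltr0n.
have d0 : 0 < p - q by rewrite subr_gt0.
exists (Num.sqrt (((p - q) * n%:R / (2 * k%:R)) ^+ 2 * (k%:R / n%:R))).
  rewrite sqrtr_gt0; apply: mulr_gt0; last by rewrite divr_gt0.
  by rewrite exprn_gt0 // divr_gt0 ?mulr_gt0.
move=> proj rule.
(* For [n < 4] the claimed bound is negative; otherwise [1 <= ln n]. *)
have [n4|n4] := ltnP n 4.
  apply: le_trans (ussbm_Pr_ge0 _ _ _); last 2 first.
  - by apply/andP; split; lra.
  - by apply/andP; split; lra.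
  rewrite subr_le0 ler_pdivlMr // mul1r.
  by rewrite (le_trans (_ : _ <= 4)) // ?ler_nat ?(ltnW n4).
pose l := ln (n%:R : R).
have l1 : 1 <= l := ln_ge1 n4.
have [m [m0 nm ml]] := @log2_le_ln R n n4.
have k1 : 1 <= k%:R :> R by rewrite ler1n.
have [h1 h2 h3 h4] := parameter_regime q0 qp p34 l1 k1 n0R hn.
have l2 : 1 <= l ^+ 2 by rewrite exprn_ege1.
have kn : (k <= n)%N.
  rewrite -(ler_nat R); apply: le_trans h4; rewrite ler_peMl // ?ltW //; lra.
have nsg : 1 <= n%:R * Num.max (p * (1 - p)) (q * (1 - q)).
  by move: hsg; rewrite ler_pdivrMr // mul1r mulrC; apply: le_trans.
have nE : n%:R = expR l by rewrite lnK.
rewrite ussbm_PrE -/(uniform_weight (R := R) (n := n) (k := k)).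
have mu0 := @uniform_weight_ge0 R n k.
have mu1 := @uniform_weight_sum1 R n k k0.
have bal := unbalanced_small (n := n) k0 l1 h4.
have e2 : k%:R * (4 * expR (- (2 * l))) <= 4 / n%:R.
  rewrite expRN; have -> : expR (2 * l) = n%:R ^+ 2 by rewrite nE -expRM_natl.
  rewrite ler_pdivlMr //.
  have -> : k%:R * (4 * (n%:R ^+ 2)^-1) * n%:R = 4 * (k%:R / n%:R) :> R.
    by field; rewrite gt_eqF.
  by rewrite -[leRHS]mulr1 ler_wpM2l // ler_pdivrMr // mul1r ler_nat.
apply: le_trans (_ : 1 - 5 / n%:R - prodE (uniform_weight (R := R))
    (fun c : {ffun 'I_n -> 'I_k} => (~~ balanced (R := R) c)%:R) <= _).
  by have := le_trans bal e2; lra.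
rewrite -[X in X - _](prodE_cst mu1) -mulN1r -prodEZ -prodED.
apply: (le_prodE mu0) => c; case: (boolP (balanced c)) => /= [bc|_].
  rewrite mulr0 addr0.
  by apply: (recovery_given_partition (l := l) (m := m)) => //; rewrite ?k0 //; lra.
have p01 : 0 <= p <= 1 by apply/andP; split; lra.
have q01 : 0 <= q <= 1 by apply/andP; split; lra.
apply: le_trans (prodE_ge0 (edge_weight_ge0 c p01 q01) (edge_weight_sum1 p q c) _) => //.
have : 0 <= 5 / n%:R :> R by rewrite divr_ge0 // ltW.
by lra.
Qed.
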